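(* Let $B,C>0$ and $\delta$ be fixed parameters, and for each (sufficiently large) $n$ let $X=X^{(n)}=(X_{ij})$ be uniformly distributed on the set $\mathscr{M}^{\{0,1\}}_{n,\delta}(B,C)$ of binary contingency tables. Fix $\varepsilon>0$. Then, as $n\to\infty$: (1) (Bottom right) If $0\le \delta<1$, $0<C<1$ and $0<B\le \frac1C$, then $$d_{TV}\left(X_{n+1,n+1},\mathrm{Ber}(C)\right)=O\left(n^{\delta-1}+n^{-\frac12+\varepsilon}\right).$$ (2) (Top left) If $\frac12<\delta<1$, $0<C<\frac34$ and $0<B<\dfrac{1}{\sqrt{\frac C3-\frac{C^2}{3}}+C}$, then $$d_{TV}\left(X_{11},\mathrm{Ber}\left(\frac{B^2(1-C)}{B^2-2B+1/C}\right)\right)=O\left(n^{\delta-1}+n^{\frac12-\delta+\varepsilon}\right).$$ (3) (Side blocks) If $0<\delta<1$, $0<C<\frac34$ and $0<B<\dfrac{1}{\sqrt{\frac C3-\frac{C^2}{3}}+C}$, then $$d_{TV}\left(X_{1,n+1},\mathrm{Ber}(BC)\right)=d_{TV}\left(X_{n+1,1},\mathrm{Ber}(BC)\right)=O\left(n^{\delta-1}+n^{-\frac{\delta}{2}+\varepsilon}\right).$$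
   Context: $[x]$ denotes the integer part of $x$. For integer vectors $\mathbf r=(r_1,\dots,r_m)$, $\mathbf c=(c_1,\dots,c_l)$ with $\sum_i r_i=\sum_j c_j$, $\mathscr{M}^{\{0,1\}}(\mathbf r,\mathbf c)$ is the set of $m\times l$ matrices with entries in $\{0,1\}$ whose $i$th row sum is $r_i$ and $j$th column sum is $c_j$ for all $i,j$. For $B,C>0$, $0\le\delta\le1$ and $n\ge1$, $\mathscr{M}^{\{0,1\}}_{n,\delta}(B,C):=\mathscr{M}^{\{0,1\}}(\widetilde{\mathbf r},\widetilde{\mathbf c})$, where $\widetilde{\mathbf r}=\widetilde{\mathbf c}\in\mathbb N^{[n^\delta]+n}$ is the vector whose first $[n^\delta]$ entries equal $[BCn]$ and whose remaining $n$ entries equal $[Cn]$. $\mathrm{Ber}(q)$ is the Bernoulli distribution with mean $q$. For random variables (or laws) $X_1,X_2$ on $\mathbb N=\{0,1,2,\dots\}$, $d_{TV}(X_1,X_2)=\frac12\sum_{k\ge0}|\mathbb P(X_1=k)-\mathbb P(X_2=k)|$. Implied constants in $O(\cdot)$ may depend on $\delta,B,C,\varepsilon$ but not on $n$. *)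

(* Defs.v *)
From HB Require Import structures.
From mathcomp Require Export all_boot all_order all_algebra.
From mathcomp Require Export all_classical all_reals all_analysis.

Set Implicit Arguments.
Unset Strict Implicit.
Unset Printing Implicit Defensive.

Import Order.TTheory GRing.Theory Num.Theory.

Local Open Scope ring_scope.

(* Entries in {0,1} are booleans, coerced to nat (true = 1) in the sums. *)
Definition binary_tables (m l : nat) (r : 'I_m -> nat) (c : 'I_l -> nat) :
    {set 'M[bool]_(m, l)} :=
  [set M : 'M[bool]_(m, l) |
     [forall i, (\sum_(j < l) M i j == r i)%N]
     && [forall j, (\sum_(i < m) M i j == c j)%N]].

(* Real arguments below are nonnegative, so Num.truncn is the integer part. *)
Definition nheavy (R : realType) (delta : R) (n : nat) : nat :=
  Num.truncn (n%:R `^ delta).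

Definition tdim (R : realType) (delta : R) (n : nat) : nat :=
  (nheavy delta n + n)%N.

Definition margin (R : realType) (delta B C : R) (n : nat)
    (i : 'I_(tdim delta n)) : nat :=
  if (i < nheavy delta n)%N then Num.truncn (B * C * n%:R)
  else Num.truncn (C * n%:R).

Definition tables (R : realType) (delta B C : R) (n : nat) :
    {set 'M[bool]_(tdim delta n, tdim delta n)} :=
  binary_tables (@margin R delta B C n) (@margin R delta B C n).

Definition uniform_pmf (R : realType) (T : finType) (S : {set T}) (x : T) : R :=
  if x \in S then #|S|%:R^-1 else 0.

(* Law on nat of the entry X_ij for X uniformly distributed on S; the ordinals
   are 0-based. *)
Definition entry_law (R : realType) (m l : nat) (S : {set 'M[bool]_(m, l)})
    (i : 'I_m) (j : 'I_l) (k : nat) : R :=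
  \sum_(M : 'M[bool]_(m, l) | (M i j : nat) == k) uniform_pmf R S M.

(* bernoulli_pmf lives on bool; it is transported to nat along true |-> 1. *)
Definition Ber (R : realType) (q : R) (k : nat) : R :=
  \sum_(b : bool | (b : nat) == k) bernoulli_pmf q b.

Definition dTV (R : realType) (P Q : nat -> R) : \bar R :=
  ((2^-1)%:E * \sum_(0 <= k <oo) (`|P k - Q k|)%:E)%E.

(* Main.v *)
Require Import Defs.
From mathcomp Require Import all_boot all_order all_algebra.
From mathcomp Require Import all_classical all_reals all_analysis.
From mathcomp Require Import perm.
From mathcomp Require Import zify ring lra.
Import Order.TTheory GRing.Theory Num.Theory.

(** Write m = [n^delta] for the number of heavy rows (and columns), a = [BCn]
and b = [Cn] for the heavy and light margins, and T for the set of tables.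
An entry is a Bernoulli variable, so its distance to Ber(x) is |p - x|, where p
is the proportion of tables having a 1 at that place ([dTV_entry_law]).
Exchanging two rows of equal margin permutes T, so p depends only on the block
of the entry.

Right blocks and their transposes.  A row of margin r has n exchangeable light
entries of mean p and only m heavy ones, so n p <= r <= n p + m.  The heavy
columns are a fraction n^(delta - 1) of all columns, whence p = r/n up to that
error ([entry_mean_bounds]).  All that remains is that T is nonempty.

Top left corner.  By symmetry p is the mean of k/m^2, where k is the number of
ones in the m x m corner ([corner_entry_count]).  Fixing k fixes the totals of
the other three blocks, so at most
  f(k) = C(m^2, k) C(mn, ma - k)^2 C(n^2, nb - ma + k)
tables have corner total k ([card_corner_total_upper]).  Conversely f(k) is at
most (n + 1)^(8n) |T| for every k ([block_count_lower]): margins that are as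
equal as possible carry the most 0-1 matrices ([card_tables_balanced]), hence at
least the average number over all margins, and there are at most (n + 1)^(2n)
pairs of margins in a block; four blocks with even margins glue to a table.
So the probability that the corner total is k is at most (n + 1)^(8n) f(k)/max f,
and this factor exp(O(n log n)) is affordable because the corner has m^2 entries
with m^2 much larger than n.

Now f(k + 1)/f(k) is about, with relative error O(m/n), the odds (1 - x)/x at
x = k/m^2 times (beta/(1 - beta))^2 (1 - C)/C with beta = BC.  That product is 1
exactly at the q of the theorem; so beyond distance h from q, on either side,
every further step away from q costs f a factor 1 - h/2
([block_count_decreasing], [block_count_increasing]).  Hence f(k) is at most
exp(- h^2 m^2/2 + h/2) (n + 1)^(8n) |T| when |k/m^2 - q| >= 2h ([corner_tail]).
Let h be a large multiple of n^(delta - 1) + n^(1/2 - delta + eps): the first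
summand absorbs the relative error O(m/n), and the second makes h^2 m^2 a large
multiple of n^(1 + 2 eps), which beats n log n.  So the mean of k/m^2 is q up to
O(h). *)

Set Implicit Arguments.
Unset Strict Implicit.
Unset Printing Implicit Defensive.

Local Open Scope ring_scope.

(** * Balanced margins carry the most 0-1 matrices *)

Lemma binary_tablesP (m l : nat) (r : 'I_m -> nat) (c : 'I_l -> nat)
    (M : 'M[bool]_(m, l)) :
  reflect ((forall i, (\sum_(j < l) M i j)%N = r i) /\
           (forall j, (\sum_(i < m) M i j)%N = c j))
          (M \in binary_tables r c).
Proof.
rewrite inE; apply: (iffP andP) => -[] H1 H2; split.
- by move=> i; apply/eqP; move/forallP: H1.
- by move=> j; apply/eqP; move/forallP: H2.
- by apply/forallP => i; apply/eqP.
- by apply/forallP => i; apply/eqP.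
Qed.

Lemma eq_binary_tables (m l : nat) (r r' : 'I_m -> nat) (c c' : 'I_l -> nat) :
  r =1 r' -> c =1 c' -> binary_tables r c = binary_tables r' c'.
Proof.
move=> er ec; apply/setP => M; apply/binary_tablesP/binary_tablesP.
  by move=> [H1 H2]; split=> i; rewrite -?er -?ec.
by move=> [H1 H2]; split=> i; rewrite ?er ?ec.
Qed.

Lemma tr_binary_tables (m l : nat) (r : 'I_m -> nat) (c : 'I_l -> nat)
    (M : 'M[bool]_(m, l)) :
  (M^T \in binary_tables c r) = (M \in binary_tables r c).
Proof.
apply/binary_tablesP/binary_tablesP => -[H1 H2]; split=> i.
- by rewrite -H2; apply: eq_bigr => j _; rewrite mxE.
- by rewrite -H1; apply: eq_bigr => j _; rewrite mxE.
- by rewrite -H2; apply: eq_bigr => j _; rewrite mxE.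
- by rewrite -H1; apply: eq_bigr => j _; rewrite mxE.
Qed.

Lemma card_binary_tables_tr (m l : nat) (r : 'I_m -> nat) (c : 'I_l -> nat) :
  #|binary_tables r c| = #|binary_tables c r|.
Proof.
rewrite -(card_imset _ (@trmx_inj bool m l)); apply: eq_card => M.
apply/imsetP/idP => [[N NT ->]|MT]; first by rewrite tr_binary_tables.
by exists M^T; rewrite ?trmxK ?tr_binary_tables.
Qed.

Definition swap_in_col (m l : nat) (i k : 'I_m) (j : 'I_l) (M : 'M[bool]_(m, l)) :=
  \matrix_(x, y) if y == j then M (tperm i k x) y else M x y.

Lemma swap_in_colK (m l : nat) (i k : 'I_m) (j : 'I_l) :
  involutive (@swap_in_col m l i k j).
Proof. by move=> M; apply/matrixP => x y; rewrite !mxE; case: eqP; rewrite ?tpermK. Qed.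

(** The number of columns in which exchanging rows i and k carries a unit from
row i to row k. *)
Definition discordance (m l : nat) (i k : 'I_m) (M : 'M[bool]_(m, l)) : nat :=
  (\sum_(j < l) (M i j && ~~ M k j))%N.

Lemma discordance_row_sums (m l : nat) (i k : 'I_m) (M : 'M[bool]_(m, l)) :
  (discordance i k M + \sum_(j < l) M k j = discordance k i M + \sum_(j < l) M i j)%N.
Proof.
rewrite /discordance -!big_split /=; apply: eq_bigr => j _.
by case: (M i j); case: (M k j).
Qed.

Lemma discordance_swap (m l : nat) (i k : 'I_m) (j : 'I_l) (M : 'M[bool]_(m, l)) :
  M i j -> ~~ M k j ->
  discordance k i (swap_in_col i k j M) = (discordance k i M).+1.
Proof.
move=> Mi Mk; rewrite /discordance (bigD1 j) //= [in RHS](bigD1 j) //= !mxE eqxx.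
rewrite tpermL tpermR Mi Mk (negbTE Mk) /=; congr (_.+1).
by rewrite add0n; apply: eq_bigr => y yj; rewrite !mxE (negbTE yj).
Qed.

Lemma swap_in_col_tables (m l : nat) (r r' : 'I_m -> nat) (c : 'I_l -> nat)
    (i k : 'I_m) (j : 'I_l) (M : 'M[bool]_(m, l)) :
  i != k -> r i = (r' i).+1 -> r' k = (r k).+1 ->
  (forall x, x != i -> x != k -> r' x = r x) ->
  M i j -> ~~ M k j ->
  M \in binary_tables r c -> swap_in_col i k j M \in binary_tables r' c.
Proof.
move=> ik ri rk rx Mi Mk /binary_tablesP[H1 H2]; apply/binary_tablesP; split.
  move=> x; have := H1 x; rewrite (bigD1 j) //= => E.
  rewrite (bigD1 j) //= mxE eqxx.
  under eq_bigr => y yj do rewrite mxE (negbTE yj).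
  have [xi|xi] := eqVneq x i.
    by move: E; rewrite xi tpermL Mi (negbTE Mk) /= ri; lia.
  have [xk|xk] := eqVneq x k.
    by move: E; rewrite xk tpermR Mi (negbTE Mk) /= rk; lia.
  by rewrite tpermD 1?eq_sym // E rx.
move=> y; rewrite -H2; have [->|yj] := eqVneq y j.
  rewrite [RHS](reindex_inj (@perm_inj _ (tperm i k))) /=.
  by apply: eq_bigr => x _; rewrite mxE eqxx.
by apply: eq_bigr => x _; rewrite mxE (negbTE yj).
Qed.

(** A switching argument.  Join M (margins r) to N (margins r') when N is M with
rows i and k exchanged in a single column.  Then M has degree
d = discordance i k M, and N has degree discordance k i M + 1, which is at most
d because row i of M is heavier than row k.  Counting each edge with weight
1/d gives total weight #|binary_tables r c|, while the weight arriving at each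
N is at most 1. *)
Lemma card_tables_unit_move (m l : nat) (r r' : 'I_m -> nat) (c : 'I_l -> nat)
    (i k : 'I_m) :
  i != k -> (r k < r i)%N -> r i = (r' i).+1 -> r' k = (r k).+1 ->
  (forall x, x != i -> x != k -> r' x = r x) ->
  (#|binary_tables r c| <= #|binary_tables r' c|)%N.
Proof.
move=> ik rki ri rk rx; rewrite -(ler_nat rat).
(* The weights of the edges at a given matrix add up to 1, unless it has none. *)
have nbr (x y : 'I_m) (M : 'M[bool]_(m, l)) :
    \sum_(j < l | M x j && ~~ M y j) (discordance x y M)%:R^-1
    = (0 < discordance x y M)%N%:R :> rat.
  rewrite sumr_const -[LHS]mulr_natl.
  have -> : #|[pred j | M x j && ~~ M y j]| = discordance x y M.
    rewrite -sum1_card /discordance big_mkcond /=.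
    by apply: eq_bigr => j _; rewrite inE; case: (_ && _).
  case: (discordance x y M) => [|d]; first by rewrite mul0r.
  by rewrite mulfV ?pnatr_eq0.
have disc (M : 'M[bool]_(m, l)) : M \in binary_tables r c ->
    (discordance k i M < discordance i k M)%N.
  move=> /binary_tablesP[H _]; have := discordance_row_sums i k M.
  by rewrite !H; lia.
rewrite -!sum1_card !natr_sum.
have -> : \sum_(M in binary_tables r c) 1%:R =
    \sum_(M in binary_tables r c) \sum_(j < l | M i j && ~~ M k j)
      (discordance i k M)%:R^-1 :> rat.
  apply: eq_bigr => M /disc d; rewrite nbr.
  by rewrite (leq_ltn_trans _ d).
apply: (@le_trans _ _ (\sum_(M in binary_tables r' c)
    \sum_(j < l | M k j && ~~ M i j) (discordance k i M)%:R^-1)); last first.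
  by apply: ler_sum => M _; rewrite nbr; case: (0 < _)%N.
rewrite (exchange_big_dep predT) //= [leRHS](exchange_big_dep predT) //=.
apply: ler_sum => j _.
(* Column by column, the switching is an involution: it matches the edges seen
   from M with the edges seen from N. *)
rewrite [leRHS](reindex_inj (inv_inj (@swap_in_colK m l i k j))) /=.
rewrite [leLHS]big_mkcond [leRHS]big_mkcond /=; apply: ler_sum => M _.
have [/andP[MA /andP[Mi Mk]]|_] := boolP (_ && _); last first.
  by case: ifP => // _; rewrite invr_ge0 ler0n.
rewrite (swap_in_col_tables ik ri rk rx Mi Mk MA) !mxE eqxx tpermL tpermR Mi Mk /=.
rewrite discordance_swap // lef_pV2 ?posrE ?ltr0n ?ler_nat //; first exact: disc.
exact: leq_ltn_trans (disc _ MA).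
Qed.

Definition balanced (m : nat) (r : 'I_m -> nat) := forall x y, (r x <= (r y).+1)%N.

(** As long as r' differs from r, some row i exceeds its target and some row k
falls short; balance of r then forces r' k < r' i, so moving a unit from i to k
does not decrease the count, and it brings r' closer to r. *)
Lemma card_tables_balanced_rows (m l : nat) (r r' : 'I_m -> nat) (c : 'I_l -> nat) :
  balanced r -> (\sum_i r' i = \sum_i r i)%N ->
  (#|binary_tables r' c| <= #|binary_tables r c|)%N.
Proof.
move=> rb; have [d] := ubnP (\sum_i (r' i - r i))%N.
elim: d r' => // d IH r' ltd sumE.
have [/forallP le_r|/forallPn[i]] := boolP [forall i, (r' i <= r i)%N].
  suff er : r' =1 r by rewrite (eq_binary_tables er (frefl _)).
  have : (\sum_i (r i - r' i) = 0)%N by rewrite sumnB // sumE subnn.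
  move/eqP; rewrite sum_nat_eq0 => /forallP e0 i.
  by have := e0 i; have := le_r i; rewrite /=; lia.
rewrite -ltnNge => ri.
have [k rk] : exists k, (r' k < r k)%N.
  apply/existsP; apply: contraPT sumE => /existsPn ge_r; apply/eqP.
  rewrite neq_ltn; apply/orP; right; rewrite (bigD1 i) //= [X in (_ < X)%N](bigD1 i) //=.
  by rewrite -addSn leq_add // leq_sum // => x _; rewrite leqNgt.
have ik : i != k by apply: contraTneq ri => ->; rewrite -leqNgt ltnW.
have rik := rb i k; have rki := rb k i.
pose s x := if x == i then (r' i).-1 else if x == k then (r' k).+1 else r' x.
have ki : (k == i) = false by rewrite eq_sym (negbTE ik).
(* Sums over two families that differ at i and k only are compared without
   subtraction, so that [lia] can conclude with truncated differences. *)
have ED (g h : 'I_m -> nat) (F : nat -> nat -> nat) :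
    (forall x, x != i -> x != k -> g x = h x) ->
    (\sum_x F (g x) (r x) + F (h i) (r i) + F (h k) (r k) = 
     \sum_x F (h x) (r x) + F (g i) (r i) + F (g k) (r k))%N.
  move=> gh; rewrite (bigD1 i) //= (bigD1 k) 1?eq_sym //=.
  rewrite [in RHS](bigD1 i) //= [in RHS](bigD1 k) 1?eq_sym //=.
  rewrite (eq_bigr (fun x => F (h x) (r x))); first by lia.
  by move=> x /andP[xi xk]; rewrite gh.
have sr x : x != i -> x != k -> s x = r' x.
  by rewrite /s => /negbTE -> /negbTE ->.
have si : s i = (r' i).-1 by rewrite /s eqxx.
have sk : s k = (r' k).+1 by rewrite /s ki eqxx.
apply: (@leq_trans #|binary_tables s c|).
  by apply: (@card_tables_unit_move _ _ _ _ _ i k) => //; rewrite ?si ?sk //; lia.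
apply: IH.
  by have := ED _ _ (fun x y => x - y)%N sr; rewrite si sk; lia.
have := ED _ _ (fun x y => x)%N sr; rewrite si sk; lia.
Qed.

Lemma card_tables_balanced (m l : nat) (r r' : 'I_m -> nat) (c c' : 'I_l -> nat) :
  balanced r -> balanced c ->
  (\sum_i r' i = \sum_i r i)%N -> (\sum_j c' j = \sum_j c j)%N ->
  (#|binary_tables r' c'| <= #|binary_tables r c|)%N.
Proof.
move=> rb cb er ec; apply: leq_trans (card_tables_balanced_rows _ rb er) _.
rewrite card_binary_tables_tr (card_binary_tables_tr r).
exact: card_tables_balanced_rows.
Qed.

Definition total (m l : nat) (M : 'M[bool]_(m, l)) : nat :=
  (\sum_(i < m) \sum_(j < l) M i j)%N.

Lemma card_total (m l s : nat) :
  #|[set M : 'M[bool]_(m, l) | total M == s]| = 'C(m * l, s).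
Proof.
have -> : (m * l = #|{: 'I_m * 'I_l}|)%N by rewrite card_prod !card_ord.
rewrite -card_draws.
pose f (M : 'M[bool]_(m, l)) := [set p : 'I_m * 'I_l | M p.1 p.2].
have fI : injective f.
  by move=> M N /setP E; apply/matrixP => i j; have := E (i, j); rewrite !inE.
have fE M : #|f M| = total M.
  rewrite /total pair_big /= -sum1_card big_mkcond /=.
  by apply: eq_bigr => p _; rewrite inE; case: (M _ _).
rewrite -(card_imset _ fI); apply: eq_card => A; rewrite inE.
apply/imsetP/eqP => [[M]|AS]; first by rewrite inE -fE => /eqP <- ->.
have AE : A = f (\matrix_(i, j) ((i, j) \in A)).
  by apply/setP => -[i j]; rewrite inE mxE.
by exists (\matrix_(i, j) ((i, j) \in A)); rewrite // inE -fE -AE AS.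
Qed.

(** The matrices of total s are distributed among at most
(l+1)^m (m+1)^l pairs of margins, and none of these classes is larger than the
balanced one. *)
Lemma card_balanced_lower (m l : nat) (r : 'I_m -> nat) (c : 'I_l -> nat) s :
  balanced r -> balanced c -> (\sum_i r i = s)%N -> (\sum_j c j = s)%N ->
  ('C(m * l, s) <= l.+1 ^ m * m.+1 ^ l * #|binary_tables r c|)%N.
Proof.
move=> rb cb rs cs; rewrite -card_total -sum1_card.
have bsum a b (f : 'I_a -> 'I_b -> bool) i : (\sum_(j < b) f i j < b.+1)%N.
  rewrite ltnS -[X in (_ <= X)%N]card_ord -sum1_card leq_sum // => j _.
  by case: (f i j).
pose rows (M : 'M[bool]_(m, l)) : {ffun 'I_m -> 'I_l.+1} :=
  [ffun i => Ordinal (bsum m l (fun i j => M i j) i)].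
pose cols (M : 'M[bool]_(m, l)) : {ffun 'I_l -> 'I_m.+1} :=
  [ffun j => Ordinal (bsum l m (fun j i => M i j) j)].
rewrite (partition_big (fun M => (rows M, cols M)) predT) //=.
have -> : (l.+1 ^ m * m.+1 ^ l * #|binary_tables r c| =
    \sum_(p : {ffun 'I_m -> 'I_l.+1} * {ffun 'I_l -> 'I_m.+1})
      #|binary_tables r c|)%N.
  by rewrite sum_nat_const card_prod !card_ffun !card_ord.
apply: leq_sum => -[u v] _; rewrite sum1_card.
set S := (X in (#|X| <= _)%N).
have [M|S0] := pickP S; last by rewrite eq_card0.
rewrite /S /= inE => /andP[/eqP Ms /eqP[Mu Mv]].
apply: (@leq_trans #|binary_tables (fun i => u i : nat) (fun j => v j : nat)|).
  apply: subset_leq_card; apply/fintype.subsetP => N.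
  rewrite -topredE /= inE => /andP[_ /eqP[Nu Nv]]; rewrite inE.
  rewrite -Nu -Nv; apply/andP.
  by split; apply/forallP => i; rewrite ffunE.
apply: card_tables_balanced => //.
  by rewrite rs -Ms -Mu; apply: eq_bigr => i _; rewrite ffunE.
rewrite cs -Ms -Mv /total exchange_big /=.
by apply: eq_bigr => i _; rewrite ffunE.
Qed.

(** * Corner totals of two-level tables *)

Definition two_level (m n a b : nat) (i : 'I_(m + n)) : nat :=
  if (i < m)%N then a else b.

Definition two_level_tables (m n a b : nat) : {set 'M[bool]_(m + n, m + n)} :=
  binary_tables (@two_level m n a b) (@two_level m n a b).

(** The number of ways to fill the four blocks when only the block totals are
prescribed; the totals are those forced by a total k in the m x m corner. *)
Definition block_count (m n a b k : nat) : nat :=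
  ('C(m * m, k) * 'C(m * n, m * a - k) ^ 2 * 'C(n * n, n * b - (m * a - k)))%N.

Lemma two_level_lshift m n a b (i : 'I_m) : two_level a b (lshift n i) = a.
Proof. by rewrite /two_level /= ltn_ord. Qed.

Lemma two_level_rshift m n a b (i : 'I_n) : two_level a b (rshift m i) = b.
Proof. by rewrite /two_level /= ltnNge leq_addr. Qed.

Lemma sum_const_ord m a : (\sum_(i < m) a = m * a)%N.
Proof. by rewrite sum_nat_const card_ord. Qed.

Lemma total_tr (m l : nat) (M : 'M[bool]_(m, l)) : total M^T = total M.
Proof.
rewrite /total exchange_big /=; apply: eq_bigr => i _.
by apply: eq_bigr => j _; rewrite mxE.
Qed.

Lemma two_level_row_sums m n a b (M : 'M[bool]_(m + n, m + n)) :
  (forall i, (\sum_(j < m + n) M i j = two_level a b i)%N) ->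
  (total (ulsubmx M) + total (ursubmx M) = m * a)%N /\
  (total (dlsubmx M) + total (drsubmx M) = n * b)%N.
Proof.
move=> H; split; rewrite /total -big_split -sum_const_ord /=; apply: eq_bigr => i _.
  rewrite -(two_level_lshift n a b i) -H big_split_ord /=.
  by congr (_ + _)%N; apply: eq_bigr => j _; rewrite !mxE.
rewrite -(two_level_rshift m a b i) -H big_split_ord /=.
by congr (_ + _)%N; apply: eq_bigr => j _; rewrite !mxE.
Qed.

(** The first a-rows give the total of the upper right block, the first
a-columns that of the lower left block, and the b-rows the remaining one. *)
Lemma two_level_totals m n a b (M : 'M[bool]_(m + n, m + n)) k :
  M \in two_level_tables m n a b -> total (ulsubmx M) = k ->
  [/\ total (ursubmx M) = (m * a - k)%N, total (dlsubmx M) = (m * a - k)%N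
    & total (drsubmx M) = (n * b - (m * a - k))%N].
Proof.
move=> MT Mk; have MTt := MT; rewrite -tr_binary_tables in MTt.
have /two_level_row_sums[H1 H2] := (proj1 (binary_tablesP _ _ _ MT)).
have /two_level_row_sums[H3 H4] := (proj1 (binary_tablesP _ _ _ MTt)).
move: H3 H4; rewrite -trmx_ulsub -trmx_dlsub -trmx_ursub -trmx_drsub !total_tr => H3 H4.
by split; lia.
Qed.

Lemma card_corner_total_upper m n a b k :
  (#|[set M in two_level_tables m n a b | total (ulsubmx M) == k]|
   <= block_count m n a b k)%N.
Proof.
set S := finset _.
pose f (M : 'M[bool]_(m + n, m + n)) :=
  ((ulsubmx M, ursubmx M), (dlsubmx M, drsubmx M)).
have fI : injective f.
  by move=> M N [E1 E2 E3 E4]; rewrite -(submxK M) -(submxK N) E1 E2 E3 E4.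
pose D p q s := [set A : 'M[bool]_(p, q) | total A == s].
rewrite -(card_imset _ fI) /block_count -!card_total.
rewrite (_ : (_ * _ ^ 2 * _ = #|finset.setX (finset.setX (D m m k) (D m n (m * a - k)%N))
   (finset.setX (D n m (m * a - k)%N) (D n n (n * b - (m * a - k))%N))|)%N); last first.
  have E : #|D n m (m * a - k)%N| = #|D m n (m * a - k)%N|.
    by rewrite /D !card_total mulnC.
  by rewrite !cardsX E /D expnS expn1; lia.
apply: subset_leq_card; apply/fintype.subsetP => _ /imsetP[M MS ->].
move: MS; rewrite inE => /andP[MT /eqP Mk].
by have [E1 E2 E3] := two_level_totals MT Mk; rewrite !inE /= Mk E1 E2 E3 !eqxx.
Qed.

(** Gluing: u and v prescribe how the margins a and b are shared between the
blocks, the same way for rows and for columns. *)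
Lemma card_two_level_lower_blocks m n a b (u : 'I_m -> nat) (v : 'I_n -> nat) :
  (forall i, (u i <= a)%N) -> (forall j, (v j <= b)%N) ->
  (#|binary_tables u u| * #|binary_tables (fun i => a - u i)%N v| ^ 2
    * #|binary_tables (fun j => b - v j)%N (fun j => b - v j)%N|
   <= #|two_level_tables m n a b|)%N.
Proof.
move=> ua vb.
pose A := binary_tables u u.
pose B := binary_tables (fun i => a - u i)%N v.
pose B' := binary_tables v (fun i => a - u i)%N.
pose D := binary_tables (fun j => b - v j)%N (fun j => b - v j)%N.
have -> : (#|A| * #|B| ^ 2 * #|D| =
    #|finset.setX (finset.setX A B) (finset.setX B' D)|)%N.
  rewrite !cardsX [#|B'|](card_binary_tables_tr v) -/B expnS expn1; lia.
pose f (p : ('M[bool]_m * 'M[bool]_(m, n)) * ('M[bool]_(n, m) * 'M[bool]_n)) :=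
  block_mx p.1.1 p.1.2 p.2.1 p.2.2.
have fI : injective f.
  by move=> [[? ?] [? ?]] [[? ?] [? ?]] /eq_block_mx [/= -> -> -> ->].
rewrite -(card_imset _ fI).
apply: subset_leq_card; apply/fintype.subsetP => _ /imsetP[[[X Y] [Z W]] /= MS ->].
move: MS; rewrite !finset.in_setX /= => /andP[/andP[]].
move=> /binary_tablesP[A1 A2] /binary_tablesP[B1 B2].
move=> /andP[/binary_tablesP[C1 C2] /binary_tablesP[D1 D2]].
apply/binary_tablesP; split=> i; rewrite big_split_ord /= /f /=.
  case: (split_ordP i) => {}i ->.
    rewrite two_level_lshift -[RHS](subnKC (ua i)).
    by congr (_ + _)%N; [rewrite -A1|rewrite -B1]; apply: eq_bigr => j _;
    rewrite (block_mxEul, block_mxEur).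
  rewrite two_level_rshift -[RHS](subnKC (vb i)).
  by congr (_ + _)%N; [rewrite -C1|rewrite -D1]; apply: eq_bigr => j _;
    rewrite (block_mxEdl, block_mxEdr).
case: (split_ordP i) => {}i ->.
  rewrite two_level_lshift -[RHS](subnKC (ua i)).
  by congr (_ + _)%N; [rewrite -A2|rewrite -C2]; apply: eq_bigr => j _;
    rewrite (block_mxEul, block_mxEdl).
rewrite two_level_rshift -[RHS](subnKC (vb i)).
by congr (_ + _)%N; [rewrite -B2|rewrite -D2]; apply: eq_bigr => j _;
    rewrite (block_mxEur, block_mxEdr).
Qed.

Definition even_split (m s : nat) (i : 'I_m) : nat := (s %/ m + (i < s %% m)%N)%N.

Lemma balanced_even_split m s : balanced (@even_split m s).
Proof. by move=> x y; rewrite /even_split; do 2!case: (_ < _)%N; lia. Qed.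

Lemma sum_even_split m s : (0 < m)%N -> (\sum_(i < m) even_split s i = s)%N.
Proof.
move=> m0; rewrite /even_split big_split /= sum_const_ord.
rewrite [RHS](divn_eq s m) mulnC; congr (_ + _)%N.
have := ltn_pmod s m0; set t := (s %% m)%N => /ltnW tm.
rewrite -(big_mkord predT (fun i => (i < t)%N : nat)) (big_cat_nat (n := t)) //=.
rewrite [X in (X + _)%N](eq_big_nat _ _ (F2 := fun=> 1%N)); last by move=> i /andP[_ ->].
rewrite [X in (_ + X)%N](eq_big_nat _ _ (F2 := fun=> 0%N)).
  by rewrite !sum_nat_const_nat; lia.
by move=> i /andP[ti _]; rewrite ltnNge ti.
Qed.

Lemma even_split_le m s a (i : 'I_m) : (s <= m * a)%N -> (even_split s i <= a)%N.
Proof.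
have m0 : (0 < m)%N by case: m i => [[]|].
rewrite /even_split => sa; have := divn_eq s m; have := ltn_pmod s m0.
set q := (s %/ m)%N; set t := (s %% m)%N => tm E.
have [it|_] := ltnP; last by rewrite addn0 -(leq_pmul2r m0); lia.
have : (q < a)%N by rewrite -(ltn_pmul2r m0); lia.
by rewrite addn1.
Qed.

Lemma balanced_sub m a (r : 'I_m -> nat) :
  balanced r -> balanced (fun i => a - r i)%N.
Proof. by move=> H x y; have := H y x; lia. Qed.

Lemma sum_sub_ord m a (r : 'I_m -> nat) : (forall i, (r i <= a)%N) ->
  (\sum_i (a - r i) = m * a - \sum_i r i)%N.
Proof. by move=> ra; rewrite sumnB // sum_const_ord. Qed.

(** Sharing every margin out evenly between the two blocks it meets makes the
margins of all four blocks balanced, so that each block loses at most a factor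
(n+1)^(2n) with respect to its binomial coefficient. *)
Lemma block_count_lower m n a b k :
  (0 < m <= n)%N -> (k <= m * a)%N -> (m * a - k <= n * b)%N ->
  (block_count m n a b k <= n.+1 ^ (8 * n) * #|two_level_tables m n a b|)%N.
Proof.
move=> /andP[m0 mn] ka kb.
have n0 := leq_trans m0 mn.
pose u := @even_split m k; pose v := @even_split n (m * a - k).
have ua i : (u i <= a)%N by apply: even_split_le.
have vb i : (v i <= b)%N by apply: even_split_le.
have ub : balanced u by apply: balanced_even_split.
have vbal : balanced v by apply: balanced_even_split.
have us : (\sum_i u i = k)%N by apply: sum_even_split.
have vs : (\sum_i v i = m * a - k)%N by apply: sum_even_split.
have X x y e : (x <= y)%N -> (x ^ e <= y ^ e)%N.
  by move=> xy; case: e => // e; rewrite leq_exp2r.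
have W p q : (p <= n)%N -> (q <= n)%N -> (q.+1 ^ p * p.+1 ^ q <= n.+1 ^ (2 * n))%N.
  move=> pn qn; rewrite mul2n -addnn expnD; apply: leq_mul.
    by apply: (@leq_trans (n.+1 ^ p)); rewrite ?leq_pexp2l ?X.
  by apply: (@leq_trans (n.+1 ^ q)); rewrite ?leq_pexp2l ?X.
have L1 := card_balanced_lower ub ub us us.
have L2 := card_balanced_lower (balanced_sub a ub) vbal 
   (etrans (sum_sub_ord ua) (congr1 (fun x => m * a - x)%N us)) vs.
have L3 := card_balanced_lower (balanced_sub b vbal) (balanced_sub b vbal)
   (etrans (sum_sub_ord vb) (congr1 (fun x => n * b - x)%N vs))
   (etrans (sum_sub_ord vb) (congr1 (fun x => n * b - x)%N vs)).
have {}L1 := leq_trans L1 (leq_mul (W m m mn mn) (leqnn _)).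
have {}L2 := leq_trans L2 (leq_mul (W m n mn (leqnn _)) (leqnn _)).
have {}L3 := leq_trans L3 (leq_mul (W n n (leqnn _) (leqnn _)) (leqnn _)).
have L := card_two_level_lower_blocks ua vb.
apply: leq_trans (leq_mul (leqnn _) L).
rewrite /block_count (_ : 8 * n = 2 * n + (2 * n + 2 * n) + 2 * n)%N; last by lia.
rewrite !expnD -mulnn in L1 L2 L3 *.
apply: (leq_trans (leq_mul (leq_mul L1 (leq_mul L2 L2)) L3)).
set w := (n.+1 ^ _)%N; set x1 := #|_|; set x2 := #|_|; set x3 := #|_|.
rewrite eq_leq //; ring.
Qed.

(** * Mean of an entry and total variation distance *)

Definition entry_count (m l : nat) (r : 'I_m -> nat) (c : 'I_l -> nat)
    (i : 'I_m) (j : 'I_l) : nat :=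
  #|[set M in binary_tables r c | M i j]|.

Lemma entry_count_le m l (r : 'I_m -> nat) (c : 'I_l -> nat) i j :
  (entry_count r c i j <= #|binary_tables r c|)%N.
Proof. by apply: subset_leq_card; apply/fintype.subsetP => M; rewrite inE => /andP[]. Qed.

Lemma entry_count_tr m l (r : 'I_m -> nat) (c : 'I_l -> nat) i j :
  entry_count r c i j = entry_count c r j i.
Proof.
rewrite /entry_count -(card_imset _ (@trmx_inj bool m l)); apply: eq_card => M.
apply/imsetP/idP => [[N + ->]|].
  by rewrite inE => /andP[NT Nij]; rewrite inE tr_binary_tables NT mxE.
rewrite inE => /andP[MT Mji]; exists M^T; rewrite ?trmxK //.
by rewrite inE tr_binary_tables MT mxE.
Qed.

Lemma entry_count_row m l (r : 'I_m -> nat) (c : 'I_l -> nat) i i' j :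
  r i = r i' -> entry_count r c i j = entry_count r c i' j.
Proof.
move=> rE; have xI : injective (@xrow bool m l i i').
  by apply: inv_inj => M; apply/matrixP => x y; rewrite !mxE tpermK.
have rt x : r (tperm i i' x) = r x by case: tpermP => // ->.
have sub M : M \in binary_tables r c -> xrow i i' M \in binary_tables r c.
  move=> /binary_tablesP[H1 H2]; apply/binary_tablesP; split=> x.
    by rewrite -rt -H1; apply: eq_bigr => y _; rewrite mxE.
  rewrite -H2 [RHS](reindex_inj (@perm_inj _ (tperm i i'))).
  by apply: eq_bigr => y _; rewrite mxE.
rewrite /entry_count -(card_imset _ xI); apply: eq_card => M.
apply/imsetP/idP => [[N + ->]|].
  by rewrite inE => /andP[NT Nij]; rewrite inE sub // mxE tpermR.
rewrite inE => /andP[MT Mij]; exists (xrow i i' M).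
  by rewrite inE sub // mxE tpermL.
by apply/matrixP => x y; rewrite !mxE tpermK.
Qed.

Lemma entry_count_col m l (r : 'I_m -> nat) (c : 'I_l -> nat) i j j' :
  c j = c j' -> entry_count r c i j = entry_count r c i j'.
Proof. by move=> cE; rewrite !(entry_count_tr r); apply: entry_count_row. Qed.

Lemma entry_countE m l (r : 'I_m -> nat) (c : 'I_l -> nat) i j :
  entry_count r c i j = (\sum_(M in binary_tables r c) M i j)%N.
Proof.
rewrite /entry_count -sum1_card big_mkcond [RHS]big_mkcond /=.
by apply: eq_bigr => M _; rewrite inE; case: (_ \in _); case: (M i j).
Qed.

Lemma sum_entry_count_row m l (r : 'I_m -> nat) (c : 'I_l -> nat) i :
  (\sum_j entry_count r c i j = r i * #|binary_tables r c|)%N.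
Proof.
under eq_bigr do rewrite entry_countE.
rewrite exchange_big /= mulnC -sum_nat_const; apply: eq_bigr => M.
by move=> /binary_tablesP[-> _].
Qed.

(** The n light entries of row i all have the same count N, and each of the m
heavy ones has count at most T. *)
Lemma two_level_row_count m n a b (i : 'I_(m + n)) (j : 'I_n) :
  let N := entry_count (two_level a b) (two_level a b) i (rshift m j) in
  let T := #|two_level_tables m n a b| in
  (n * N <= two_level a b i * T)%N /\ (two_level a b i * T <= n * N + m * T)%N.
Proof.
move=> N T; rewrite /T -sum_entry_count_row big_split_ord /=.
rewrite [X in (_ + X)%N](_ : _ = n * N)%N; last first.
  rewrite -sum_const_ord; apply: eq_bigr => j' _; apply: entry_count_col.
  by rewrite !two_level_rshift.
split; first exact: leq_addl.
rewrite addnC leq_add2l /= -sum_const_ord; apply: leq_sum => j' _.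
exact: entry_count_le.
Qed.

Lemma corner_entry_count m n a b (i j : 'I_m) :
  (m * (m * entry_count (two_level a b) (two_level a b) (lshift n i) (lshift n j))
   = \sum_(M in two_level_tables m n a b) total (ulsubmx M))%N.
Proof.
rewrite /total exchange_big /= -sum_const_ord; apply: eq_bigr => i' _.
rewrite exchange_big /= -sum_const_ord; apply: eq_bigr => j' _.
rewrite (@entry_count_col _ _ _ _ _ _ (lshift n j')) ?two_level_lshift //.
rewrite (@entry_count_row _ _ _ _ _ (lshift n i')) ?two_level_lshift //.
by rewrite entry_countE; apply: eq_bigr => M _; rewrite !mxE.
Qed.

Lemma entry_lawE (R : realType) m l (S : {set 'M[bool]_(m, l)}) i j k :
  let p : R := #|[set M in S | M i j]|%:R / #|S|%:R in
  S != finset.set0 ->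
  entry_law R S i j k = if k is k'.+1 then (if k' is 0%N then p else 0) else 1 - p.
Proof.
move=> p S0.
have Sp : #|S|%:R != 0 :> R by rewrite pnatr_eq0 cards_eq0.
have E (b : bool) : entry_law R S i j b = #|[set M in S | M i j == b]|%:R / #|S|%:R.
  rewrite /entry_law /uniform_pmf -big_mkcondr /= sumr_const -[LHS]mulr_natl.
  congr (_%:R * _); apply: eq_card => M; rewrite !inE unfold_in /= andbC.
  by case: (M i j); case: b.
have C1 : [set M in S | M i j == true] = [set M in S | M i j].
  by apply/setP => M; rewrite !inE eqb_id.
have C0 : #|[set M in S | M i j == false]|%:R = #|S|%:R - #|[set M in S | M i j]|%:R :> R.
  rewrite -(cardsID [set M : 'M[bool]_(m, l) | M i j] S) natrD addrAC.
  rewrite (_ : finset.setI _ _ = [set M in S | M i j]); last first.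
    by apply/setP => M; rewrite !inE.
  rewrite subrr add0r; congr (_%:R); apply: eq_card => M; rewrite !inE andbC.
  by case: (M i j).
case: k => [|[|k]]; first by rewrite (E false) C0 mulrBl mulfV.
  by rewrite (E true) C1.
by rewrite /entry_law big_pred0 // => M; case: (M i j).
Qed.

Lemma BerE (R : realType) (q : R) k :
  Ber q k = if k is k'.+1 then (if k' is 0%N then q else 0) else 1 - q.
Proof.
rewrite /Ber big_mkcond big_bool /= /bernoulli_pmf.
by case: k => [|[|k]] /=; rewrite ?addr0 ?add0r.
Qed.

Lemma dTV_entry_law (R : realType) m l (S : {set 'M[bool]_(m, l)}) i j (q : R) :
  S != finset.set0 ->
  dTV (entry_law R S i j) (Ber q) =
  (`|#|[set M in S | M i j]|%:R / #|S|%:R - q|)%:E.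
Proof.
move=> S0; set p := _ / _; rewrite /dTV.
rewrite (nneseries_split 0 2); last by move=> k _; rewrite lee_fin.
rewrite eseries0 ?adde0; last first.
  by move=> [|[|k]] // _ _; rewrite entry_lawE // BerE subrr normr0.
rewrite add0n big_nat_recl // big_nat1 !entry_lawE // !BerE -/p -EFinD -EFinM.
congr (_%:E); rewrite (_ : 1 - p - (1 - q) = q - p); last by ring.
rewrite distrC.
by field.
Qed.

Lemma entry_mean_bounds (R : realType) m n a b (i : 'I_(m + n)) (j : 'I_(m + n)) (x : R) :
  (m <= j)%N -> two_level_tables m n a b != finset.set0 ->
  x * n%:R - 1 <= (two_level a b i)%:R <= x * n%:R ->
  `|#|[set M in two_level_tables m n a b | M i j]|%:R
     / #|two_level_tables m n a b|%:R - x| <= (m%:R + 1) / n%:R.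
Proof.
case: (split_ordP j) => {}j -> mj T0; first by move: mj; rewrite /= leqNgt ltn_ord.
have n0 : 0 < n%:R :> R by rewrite ltr0n (leq_trans _ (ltn_ord j)).
have [] := @two_level_row_count m n a b i j.
rewrite /entry_count -/(two_level_tables m n a b) => H1 H2 /andP[X1 X2].
set N := #|finset _| in H1 H2 *.
set T := #|two_level_tables m n a b| in H1 H2 *.
have T1 : 0 < T%:R :> R by rewrite ltr0n card_gt0.
set p := N%:R / T%:R.
have pN : N%:R = p * T%:R by rewrite /p divfK // gt_eqF.
move: p pN => p pN.
move: H1 H2; rewrite -!(ler_nat R) natrD !natrM pN !mulrA -mulrDl !ler_pM2r // => H1 H2.
have m0 := ler0n R m.
have n1 : 0 < n%:R^-1 :> R by rewrite invr_gt0.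
have -> : p - x = (n%:R * p - x * n%:R) / n%:R by field; rewrite gt_eqF.
by rewrite normrM (gtr0_norm n1) ler_pM2r // ler_norml; apply/andP; split; lra.
Qed.

(** * Successive ratios of the block count *)

(** The exact ratio f(k+1)/f(k), cleared of denominators. *)
Lemma block_count_step m n a b k :
  (k < m * a)%N -> (a <= n)%N -> (m * a <= n * b)%N -> (b <= n)%N ->
  (block_count m n a b k.+1 *
     (k.+1 * (m * n - m * a + k.+1) ^ 2 * (n * b - m * a + k.+1)) =
   block_count m n a b k *
     ((m * m - k) * (m * a - k) ^ 2 * (n * n - n * b + (m * a - k))))%N.
Proof.
move=> ka an ab bn; rewrite /block_count.
have mamn : (m * a <= m * n)%N by rewrite leq_mul2l an orbT.
have nbnn : (n * b <= n * n)%N by rewrite leq_mul2l bn orbT.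
have [s sE] : exists s, (m * a = k + s.+1)%N.
  by exists (m * a - k.+1)%N; lia.
have e1 : (m * a - k = s.+1)%N by lia.
have e2 : (m * a - k.+1 = s)%N by lia.
have e3 : (n * b - s = (n * b - s.+1).+1)%N by lia.
have e4 : (m * n - m * a + k.+1 = m * n - s)%N by lia.
have e5 : (n * b - m * a + k.+1 = (n * b - s.+1).+1)%N by lia.
have e6 : (n * n - n * b + s.+1 = n * n - (n * b - s.+1))%N by lia.
rewrite e1 e2 e3 e4 e5 e6.
have H1 := mul_bin_left (m * m) k.
have H2 := mul_bin_left (m * n) s.
have H3 := mul_bin_left (n * n) (n * b - s.+1).
rewrite -!mulnn.
move: 'C(_, k.+1) 'C(_, k) H1 => x x' H1.
move: 'C(_, s.+1) 'C(_, s) H2 => y y' H2.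
move: 'C(_, (n * b - s.+1).+1) 'C(_, n * b - s.+1) H3 => z z' H3.
transitivity ((k.+1 * x) * ((m * n - s) * y') ^ 2 * ((n * b - s.+1).+1 * z))%N.
  by rewrite -mulnn; ring.
by rewrite H1 -H2 H3 -mulnn; ring.
Qed.

(** Here beta stands for BC and tau for (m+1)/n, which bounds the relative error
caused by the heavy lines and by integer parts.  The equation [qE] says that the
odds of q are (beta/(1-beta))^2 (1-C)/C, that is, that the limiting ratio
f(k+1)/f(k) equals 1 at k = q m^2. *)
Section CornerConcentration.
Context {R : realType} {m n a b : nat} {beta C q h tau : R}.
Hypothesis m_gt0 : (0 < m)%N.
Hypothesis m_le_n : (m <= n)%N.
Hypothesis beta01 : 0 < beta < 1.
Hypothesis C01 : 0 < C < 1.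
Hypothesis aE : beta * n%:R - 1 <= a%:R <= beta * n%:R.
Hypothesis bE : C * n%:R - 1 <= b%:R <= C * n%:R.
Hypothesis q01 : 0 < q < 1.
Hypothesis qE : (1 - q) * (beta ^+ 2 * (1 - C)) = q * ((1 - beta) ^+ 2 * C).
Hypothesis tauE : tau * n%:R = m%:R + 1.
Hypothesis h_tau :
  6 * (tau / beta) + 6 * (tau / (1 - beta)) + 6 * (tau / C) + 6 * (tau / (1 - C)) <= h.
Hypothesis h_le1 : h <= 1.

Local Notation f k := (block_count m n a b k).

Let n0 : 0 < n%:R :> R.
Proof. by rewrite ltr0n (leq_trans m_gt0). Qed.

Let m0 : 1 <= m%:R :> R.
Proof. by rewrite ler1n. Qed.

Let tau_gt0 : 0 < tau.
Proof. by rewrite -(pmulr_lgt0 _ n0) tauE ltr_wpDl. Qed.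

Let tau_fractions : [/\ 0 < tau / beta, 0 < tau / (1 - beta), 0 < tau / C
  & 0 < tau / (1 - C)].
Proof.
move: beta01 C01 => /andP[b0 b1] /andP[c0 c1].
by rewrite !divr_gt0 ?subr_gt0.
Qed.

Let tau_le_beta : tau <= beta.
Proof.
move: beta01 => /andP[b0 b1]; case: tau_fractions => t1 t2 t3 t4.
have ht := h_tau; have hle := h_le1.
have : tau / beta <= 1 by lra.
by rewrite ler_pdivrMr // mul1r.
Qed.

Let tau_le_C : tau <= C.
Proof.
move: C01 => /andP[c0 c1]; case: tau_fractions => t1 t2 t3 t4.
have ht := h_tau; have hle := h_le1.
have : tau / C <= 1 by lra.
by rewrite ler_pdivrMr // mul1r.
Qed.

Let m_le_a : (m <= a)%N.
Proof.
have m_ge1 := m0; have tg := n0; rewrite -(ler_nat R).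
have : tau * n%:R <= beta * n%:R by rewrite ler_pM2r.
by rewrite tauE; move: aE => /andP[]; lra.
Qed.

Let a_le_n : (a <= n)%N.
Proof.
have m_ge1 := m0; have tg := n0; rewrite -(ler_nat R).
have : beta * n%:R <= 1 * n%:R by rewrite ler_pM2r //; move: beta01; lra.
by move: aE => /andP[]; lra.
Qed.

Let b_le_n : (b <= n)%N.
Proof.
have m_ge1 := m0; have tg := n0; rewrite -(ler_nat R).
have : C * n%:R <= 1 * n%:R by rewrite ler_pM2r //; move: C01; lra.
by move: bE => /andP[]; lra.
Qed.

Let m_le_b : (m <= b)%N.
Proof.
have m_ge1 := m0; have tg := n0; rewrite -(ler_nat R).
have : tau * n%:R <= C * n%:R by rewrite ler_pM2r.
by rewrite tauE; move: bE => /andP[]; lra.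
Qed.

Let ma_le_nb : (m * a <= n * b)%N.
Proof. by rewrite mulnC leq_mul. Qed.

Let block_count_stepR k : (k < m * m)%N ->
  (f k.+1)%:R * (k.+1%:R * (m%:R * n%:R - m%:R * a%:R + k.+1%:R) ^+ 2
                 * (n%:R * b%:R - m%:R * a%:R + k.+1%:R)) =
  (f k)%:R * ((m%:R * m%:R - k%:R) * (m%:R * a%:R - k%:R) ^+ 2
              * (n%:R * n%:R - n%:R * b%:R + (m%:R * a%:R - k%:R))) :> R.
Proof.
move=> km; have kma : (k < m * a)%N by rewrite (leq_trans km) // leq_mul.
have := block_count_step kma a_le_n ma_le_nb b_le_n.
move/(congr1 (fun x => x%:R : R)).
rewrite -!mulnn !expr2 !natrM !natrD.
by rewrite !natrB ?natrM ?ma_le_nb ?leq_mul ?(ltnW km) ?(ltnW kma).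
Qed.


(** At distance h beyond q the main term of the ratio is at most 1 - h, and the
error terms, of relative size tau/C + tau/(1-C), use up at most half of that gain. *)
Let scalar_decreasing : q + h <= 1 ->
  (1 - q - h) * beta ^+ 2 * (1 - C + tau)
  <= (1 - h / 2) * ((q + h) * (1 - beta) ^+ 2 * (C - tau)).
Proof.
move=> qh; move: beta01 C01 q01 => /andP[b0 b1] /andP[c0 c1] /andP[q0 q1].
have ht := h_tau; have hle := h_le1.
have [t1 t2 t3 t4] := tau_fractions.
set v := tau / C in t3; set w := tau / (1 - C) in t4.
have tv : tau = C * v by rewrite /v; field; rewrite gt_eqF.
have tw : tau = (1 - C) * w by rewrite /w; field; rewrite gt_eqF // subr_gt0.
have hw : 6 * v + 6 * w <= h by move: h_tau; rewrite -/v -/w; lra.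
rewrite {1}tw tv; clearbody v w.
have YE := qE; set U := beta ^+ 2 * (1 - C) in YE *; set V := (1 - beta) ^+ 2 * C in YE *.
have U0 : 0 < U by rewrite mulr_gt0 ?exprn_gt0 ?subr_gt0.
have V0 : 0 < V by rewrite mulr_gt0 ?exprn_gt0 ?subr_gt0.
rewrite [leLHS](_ : _ = (1 - q - h) * U * (1 + w)); last by rewrite /U; ring.
rewrite [leRHS](_ : _ = (1 - h / 2) * ((q + h) * V * (1 - v))); last by rewrite /V; ring.
clearbody U V; set Y := q * V in YE.
have Y0 : 0 < Y by rewrite mulr_gt0.
have h0 : 0 < h by lra.
have L1 : (1 - q - h) * U <= (1 - h) * Y.
  have : 0 <= h * (q * U) by rewrite !mulr_ge0 ?ltW.
  by rewrite -YE; lra.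
have L2 : Y <= (q + h) * V.
  have : 0 <= h * V by rewrite mulr_ge0 ?ltW.
  by rewrite /Y; lra.
apply: (@le_trans _ _ ((1 - h) * Y * (1 + w))); first by rewrite ler_wpM2r //; lra.
apply: (@le_trans _ _ ((1 - h / 2) * (Y * (1 - v)))); last first.
  by rewrite ler_wpM2l ?ler_wpM2r //; lra.
rewrite [leLHS]mulrAC [leLHS]mulrC [leRHS]mulrCA ler_pM2l //.
have : 0 <= h * w by rewrite mulr_ge0 ?ltW.
have : 0 <= h * v by rewrite mulr_ge0 ?ltW.
by lra.
Qed.

(** The inverse ratio gains 1 - h in the same way.  The error now sits in the
squared factors, because a is bounded from below this time. *)
Let scalar_increasing : h <= q ->
  (q - h) * (1 - beta + tau) ^+ 2 * C
  <= (1 - h / 2) * ((1 - q + h) * (beta - tau) ^+ 2 * (1 - C)).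
Proof.
move=> qh; move: beta01 C01 q01 => /andP[b0 b1] /andP[c0 c1] /andP[q0 q1].
have ht := h_tau; have hle := h_le1.
have [t1 t2 t3 t4] := tau_fractions.
set v := tau / beta in t1; set w := tau / (1 - beta) in t2.
have tv : tau = beta * v by rewrite /v; field; rewrite gt_eqF.
have tw : tau = (1 - beta) * w by rewrite /w; field; rewrite gt_eqF // subr_gt0.
have hw : 6 * v + 6 * w <= h by move: h_tau; rewrite -/v -/w; lra.
rewrite {1}tw tv; clearbody v w.
have YE := qE; set U := beta ^+ 2 * (1 - C) in YE *; set V := (1 - beta) ^+ 2 * C in YE *.
have U0 : 0 < U by rewrite mulr_gt0 ?exprn_gt0 ?subr_gt0.
have V0 : 0 < V by rewrite mulr_gt0 ?exprn_gt0 ?subr_gt0.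
rewrite [leLHS](_ : _ = (q - h) * V * (1 + w) ^+ 2); last by rewrite /V; ring.
rewrite [leRHS](_ : _ = (1 - h / 2) * ((1 - q + h) * U * (1 - v) ^+ 2)); last first.
  by rewrite /U; ring.
clearbody U V; set Y := q * V in YE.
have Y0 : 0 < Y by rewrite mulr_gt0.
have h0 : 0 < h by lra.
have L1 : (q - h) * V <= (1 - h) * Y.
  have : 0 <= h * ((1 - q) * V) by rewrite !mulr_ge0 ?ltW // subr_gt0.
  by rewrite /Y; lra.
have L2 : Y <= (1 - q + h) * U.
  have : 0 <= h * U by rewrite mulr_ge0 ?ltW.
  by rewrite -YE; lra.
apply: (@le_trans _ _ ((1 - h) * Y * (1 + w) ^+ 2)); first by rewrite ler_wpM2r ?sqr_ge0.
apply: (@le_trans _ _ ((1 - h / 2) * (Y * (1 - v) ^+ 2))); last first.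
  by rewrite ler_wpM2l ?ler_wpM2r ?sqr_ge0 //; lra.
rewrite [leLHS]mulrAC [leLHS]mulrC [leRHS]mulrCA ler_pM2l //.
apply: (@le_trans _ _ ((1 - h) * (1 + 3 * w))).
  rewrite ler_wpM2l ?subr_ge0 // sqrrD expr1n mul1r expr2.
  have : w * w <= w * 1 by rewrite ler_pM2l //; lra.
  by lra.
apply: (@le_trans _ _ ((1 - h / 2) * (1 - 2 * v))); last first.
  rewrite ler_wpM2l //; first by lra.
  by rewrite sqrrB expr1n mul1r; have := sqr_ge0 v; lra.
have : 0 <= h * w by rewrite mulr_ge0 ?ltW.
have : 0 <= h * v by rewrite mulr_ge0 ?ltW.
by lra.
Qed.

(** After division by m^4 n^4 each factor of the exact ratio is replaced by its
value at x = q + h, up to tau.  Here [G * lo] bounds the denominator from below,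
and the claim reduces to [scalar_decreasing]. *)
Lemma block_count_decreasing k :
  (k < m * m)%N -> (q + h) * (m%:R * m%:R) <= k%:R ->
  (f k.+1)%:R <= (1 - h / 2) * (f k)%:R :> R.
Proof.
move=> km xk.
move: beta01 C01 q01 => /andP[b0 b1] /andP[c0 c1] /andP[q0 q1].
have /andP[a1 a2] := aE; have /andP[bb1 bb2] := bE.
have ht := h_tau; have hle := h_le1; have m_ge1 := m0; have tg := tau_gt0.
have mpos : 0 < m%:R :> R by rewrite ltr0n.
have mmpos : 0 < m%:R * m%:R :> R by rewrite mulr_gt0.
have tau_lt_C : tau < C.
  have [t1 t2 t3 t4] := tau_fractions.
  have : tau / C < 1 by lra.
  by rewrite ltr_pdivrMr // mul1r.
have h0 : 0 < h by have [] := tau_fractions; lra.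
clear ht hle.
have k1 : k%:R <= m%:R * m%:R :> R by rewrite -natrM ler_nat ltnW.
have qh : q + h <= 1 by rewrite -(ler_pM2r mmpos) mul1r (le_trans xk).
have mn2 : m%:R * (tau * n%:R) = m%:R * m%:R + m%:R by rewrite tauE mulrDr mulr1.
have man : m%:R * a%:R <= m%:R * n%:R :> R by rewrite ler_pM2l // ler_nat.
have ma1 : m%:R * a%:R <= m%:R * (beta * n%:R) by rewrite ler_pM2l.
have kma : k%:R <= m%:R * a%:R :> R.
  by rewrite -natrM ler_nat (leq_trans (ltnW km)) // leq_mul.
have nb1 : n%:R * (C * n%:R - 1) <= n%:R * b%:R by rewrite ler_pM2l.
have tn : n%:R * (tau * n%:R) = n%:R * m%:R + n%:R by rewrite tauE mulrDr mulr1.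
have kS : k.+1%:R = k%:R + 1 :> R by rewrite -natr1.
have k0 : 0 <= k%:R :> R by [].
clear a1 a2 bb1 bb2 m_ge1.
set mm := m%:R * m%:R in k1 xk mn2 mmpos.
set G := mm * (m%:R * n%:R) ^+ 2 * (n%:R * n%:R).
have G0 : 0 < G by rewrite !mulr_gt0 ?exprn_gt0 ?mulr_gt0.
pose lo := (q + h) * (1 - beta) ^+ 2 * (C - tau).
have lo0 : 0 < lo.
  by rewrite !mulr_gt0 ?exprn_gt0 ?subr_gt0 //; lra.
have nbmn : n%:R * b%:R <= n%:R * n%:R :> R by rewrite ler_pM2l // ler_nat.
have man0 : 0 <= m%:R * a%:R :> R by rewrite mulr_ge0.
have H1 : G * lo <= k.+1%:R * (m%:R * n%:R - m%:R * a%:R + k.+1%:R) ^+ 2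
                 * (n%:R * b%:R - m%:R * a%:R + k.+1%:R).
  rewrite (_ : G * lo = ((q + h) * mm) * (m%:R * n%:R * (1 - beta)) ^+ 2
     * (n%:R * n%:R * (C - tau))); last by rewrite /G /lo; ring.
  apply: ler_pM.
  - by rewrite mulr_ge0 ?sqr_ge0 // mulr_ge0 ?ltW //; lra.
  - by rewrite mulr_ge0 ?mulr_ge0 ?subr_ge0 ?ltW.
  - apply: ler_pM; rewrite ?sqr_ge0 //; first by rewrite mulr_ge0 ?ltW //; lra.
      by lra.
    rewrite ler_pXn2r ?nnegrE //; first by lra.
      by rewrite !mulr_ge0 ?subr_ge0 ?ltW.
    by lra.
  - by lra.
have H2 : (mm - k%:R) * (m%:R * a%:R - k%:R) ^+ 2
              * (n%:R * n%:R - n%:R * b%:R + (m%:R * a%:R - k%:R))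
          <= (1 - h / 2) * (G * lo).
  rewrite [leRHS]mulrCA.
  apply: le_trans (_ : G * ((1 - q - h) * beta ^+ 2 * (1 - C + tau)) <= _); last first.
    by rewrite ler_pM2l // scalar_decreasing.
  rewrite (_ : G * _ = ((1 - q - h) * mm) * (m%:R * (beta * n%:R)) ^+ 2
     * (n%:R * n%:R * (1 - C + tau))); last by rewrite /G; ring.
  apply: ler_pM.
  - by rewrite mulr_ge0 ?sqr_ge0 // subr_ge0.
  - by lra.
  - apply: ler_pM; rewrite ?sqr_ge0 ?subr_ge0 //; first by lra.
    rewrite ler_pXn2r ?nnegrE ?subr_ge0 //; first by lra.
    by rewrite !mulr_ge0 ?ltW.
  - by lra.
have F0 : 0 <= (f k)%:R :> R by rewrite ler0n.
have F1 : 0 <= (f k.+1)%:R :> R by rewrite ler0n.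
have stepE := block_count_stepR km; rewrite -/mm in stepE.
have L : (f k.+1)%:R * (G * lo) <= (f k)%:R * ((1 - h / 2) * (G * lo)).
  by apply: (le_trans (ler_wpM2l F1 H1)); rewrite stepE ler_wpM2l.
rewrite -(ler_pM2r (mulr_gt0 G0 lo0)); apply: (le_trans L).
by rewrite mulrCA mulrA.
Qed.

(** The same estimate for the inverse ratio, with numerator and denominator
exchanged and x = q - h; see [scalar_increasing]. *)
Lemma block_count_increasing k :
  (k < m * m)%N -> k.+1%:R <= (q - h) * (m%:R * m%:R) ->
  (f k)%:R <= (1 - h / 2) * (f k.+1)%:R :> R.
Proof.
move=> km xk.
move: beta01 C01 q01 => /andP[b0 b1] /andP[c0 c1] /andP[q0 q1].
have /andP[a1 a2] := aE; have /andP[bb1 bb2] := bE.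
have ht := h_tau; have hle := h_le1; have m_ge1 := m0; have tg := tau_gt0.
have mpos : 0 < m%:R :> R by rewrite ltr0n.
have mmpos : 0 < m%:R * m%:R :> R by rewrite mulr_gt0.
have tau_lt_b : tau < beta.
  have [t1 t2 t3 t4] := tau_fractions.
  have : tau / beta < 1 by lra.
  by rewrite ltr_pdivrMr // mul1r.
have h0 : 0 < h by have [] := tau_fractions; lra.
clear ht hle.
have k1 : k.+1%:R <= m%:R * m%:R :> R by rewrite -natrM ler_nat.
have k0 : 0 <= k%:R :> R by [].
have kS : k.+1%:R = k%:R + 1 :> R by rewrite -natr1.
have qh : h <= q.
  by rewrite -subr_ge0 -(ler_pM2r mmpos) mul0r (le_trans _ xk) // ler0n.
have mn2 : m%:R * (tau * n%:R) = m%:R * m%:R + m%:R by rewrite tauE mulrDr mulr1.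
have man : m%:R * a%:R <= m%:R * n%:R :> R by rewrite ler_pM2l // ler_nat.
have ma1 : m%:R * (beta * n%:R - 1) <= m%:R * a%:R by rewrite ler_pM2l.
have kma : k.+1%:R <= m%:R * a%:R :> R.
  by rewrite -natrM ler_nat (leq_trans km) // leq_mul.
have nb1 : n%:R * b%:R <= n%:R * (C * n%:R) by rewrite ler_pM2l.
have tn : n%:R * (tau * n%:R) = n%:R * m%:R + n%:R by rewrite tauE mulrDr mulr1.
have manb : m%:R * a%:R <= n%:R * b%:R :> R by rewrite -!natrM ler_nat.
clear a1 a2 bb1 bb2 m_ge1.
set mm := m%:R * m%:R in k1 xk mn2 mmpos.
set G := mm * (m%:R * n%:R) ^+ 2 * (n%:R * n%:R).
have G0 : 0 < G by rewrite !mulr_gt0 ?exprn_gt0 ?mulr_gt0.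
pose lo := (1 - q + h) * (beta - tau) ^+ 2 * (1 - C).
have lo0 : 0 < lo.
  by rewrite !mulr_gt0 ?exprn_gt0 ?subr_gt0 //; lra.
have nbmn : n%:R * b%:R <= n%:R * n%:R :> R by rewrite ler_pM2l // ler_nat.
have H1 : G * lo <= (mm - k%:R) * (m%:R * a%:R - k%:R) ^+ 2
              * (n%:R * n%:R - n%:R * b%:R + (m%:R * a%:R - k%:R)).
  rewrite (_ : G * lo = ((1 - q + h) * mm) * (m%:R * n%:R * (beta - tau)) ^+ 2
     * (n%:R * n%:R * (1 - C))); last by rewrite /G /lo; ring.
  apply: ler_pM.
  - by rewrite mulr_ge0 ?sqr_ge0 // mulr_ge0 ?ltW //; lra.
  - by rewrite mulr_ge0 ?mulr_ge0 ?subr_ge0 ?ltW.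
  - apply: ler_pM; rewrite ?sqr_ge0 //; first by rewrite mulr_ge0 ?ltW //; lra.
      by lra.
    rewrite ler_pXn2r ?nnegrE //; first by lra.
      by rewrite !mulr_ge0 ?subr_ge0 ?ltW.
    by lra.
  - by lra.
have H2 : k.+1%:R * (m%:R * n%:R - m%:R * a%:R + k.+1%:R) ^+ 2
                 * (n%:R * b%:R - m%:R * a%:R + k.+1%:R)
          <= (1 - h / 2) * (G * lo).
  rewrite [leRHS]mulrCA.
  apply: le_trans (_ : G * ((q - h) * (1 - beta + tau) ^+ 2 * C) <= _); last first.
    by rewrite ler_pM2l // scalar_increasing.
  rewrite (_ : G * _ = ((q - h) * mm) * (m%:R * n%:R * (1 - beta + tau)) ^+ 2
     * (n%:R * n%:R * C)); last by rewrite /G; ring.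
  apply: ler_pM.
  - by rewrite mulr_ge0 ?sqr_ge0 // ler0n.
  - by rewrite addr_ge0 ?subr_ge0.
  - apply: ler_pM; rewrite ?sqr_ge0 ?ler0n //.
    rewrite ler_pXn2r ?nnegrE //; first by lra.
      by rewrite addr_ge0 ?subr_ge0.
    by rewrite !mulr_ge0 ?ltW //; lra.
  - by lra.
have F0 : 0 <= (f k)%:R :> R by rewrite ler0n.
have F1 : 0 <= (f k.+1)%:R :> R by rewrite ler0n.
have stepE := block_count_stepR km; rewrite -/mm in stepE.
have L : (f k)%:R * (G * lo) <= (f k.+1)%:R * ((1 - h / 2) * (G * lo)).
  by apply: (le_trans (ler_wpM2l F0 H1)); rewrite -stepE ler_wpM2l.
rewrite -(ler_pM2r (mulr_gt0 G0 lo0)); apply: (le_trans L).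
by rewrite mulrCA mulrA.
Qed.

End CornerConcentration.

(** * Concentration of the corner total *)

(** Each step beyond c costs a factor 1 - h/2 <= exp(-h/2); up to c + 1 the
right-hand side is at least F. *)
Lemma geometric_tail (R : realType) (g : nat -> R) (N : nat) (c h F : R) :
  0 <= h -> 0 <= c -> 0 <= F ->
  (forall k, (k <= N)%N -> 0 <= g k <= F) ->
  (forall k, (k < N)%N -> c <= k%:R -> g k.+1 <= (1 - h / 2) * g k) ->
  forall k, (k <= N)%N -> g k <= expR (- (h / 2) * (k%:R - c - 1)) * F.
Proof.
move=> h0 c0 F0 gF gS.
have trivial k : (k <= N)%N -> k%:R - c - 1 <= 0 ->
    g k <= expR (- (h / 2) * (k%:R - c - 1)) * F.
  move=> kN kc; have /andP[_] := gF k kN; move=> /le_trans; apply.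
  rewrite -[leLHS]mul1r ler_wpM2r //.
  apply: le_trans (expR_ge1Dx _); rewrite lerDl mulNr -mulrN mulr_ge0 ?divr_ge0 //.
  by rewrite oppr_ge0.
elim=> [|k IH] kN; first by apply: trivial => //; lra.
have [ck|ck] := leP c k%:R; last by apply: trivial => //; rewrite -natr1; lra.
apply: (le_trans (gS k kN ck)).
have -> : - (h / 2) * (k.+1%:R - c - 1) = - (h / 2) + - (h / 2) * (k%:R - c - 1).
  by rewrite -natr1; ring.
have /andP[gk0 _] := gF k (ltnW kN).
rewrite expRD -mulrA.
apply: (@le_trans _ _ (expR (- (h / 2)) * g k)).
  by rewrite ler_wpM2r //; exact: expR_ge1Dx.
by rewrite ler_wpM2l ?expR_ge0 // IH // ltnW.
Qed.

(** [geometric_tail] read from the other end, with N - k for k. *)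
Lemma geometric_tail_rev (R : realType) (g : nat -> R) (N : nat) (c h F : R) :
  0 <= h -> c <= N%:R -> 0 <= F ->
  (forall k, (k <= N)%N -> 0 <= g k <= F) ->
  (forall k, (k < N)%N -> k.+1%:R <= c -> g k <= (1 - h / 2) * g k.+1) ->
  forall k, (k <= N)%N -> g k <= expR (- (h / 2) * (c - k%:R - 1)) * F.
Proof.
move=> h0 cN F0 gF gS k kN.
have := @geometric_tail R (fun k => g (N - k)%N) N (N%:R - c) h F h0.
rewrite subr_ge0 cN => /(_ isT F0) T.
have {}T := T _ _ (N - k)%N (leq_subr _ _); rewrite subKn // natrB // in T.
rewrite (_ : c - k%:R - 1 = N%:R - k%:R - (N%:R - c) - 1); last by ring.
apply: T => [x xN|x xN xc]; first by rewrite gF // leq_subr.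
have e : (N - x = (N - x.+1).+1)%N by lia.
rewrite e; apply: gS; first by lia.
by rewrite -e natrB ?(ltnW xN) //; lra.
Qed.

(** Between distance h and distance 2h from q m^2 there are about h m^2 steps,
each costing a factor exp(-h/2). *)
Lemma corner_tail (R : realType) (m n a b : nat) (beta C q h tau : R) :
  (0 < m)%N -> (m <= n)%N -> 0 < beta < 1 -> 0 < C < 1 ->
  beta * n%:R - 1 <= a%:R <= beta * n%:R -> C * n%:R - 1 <= b%:R <= C * n%:R ->
  0 < q < 1 -> (1 - q) * (beta ^+ 2 * (1 - C)) = q * ((1 - beta) ^+ 2 * C) ->
  tau * n%:R = m%:R + 1 ->
  6 * (tau / beta) + 6 * (tau / (1 - beta)) + 6 * (tau / C) + 6 * (tau / (1 - C)) <= h ->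
  0 < h <= 1 -> (m <= a)%N -> (m * a <= n * b)%N ->
  forall k, (k <= m * m)%N ->
  2 * h * (m * m)%:R <= `|k%:R - q * (m * m)%:R| ->
  (block_count m n a b k)%:R <= expR (h / 2 - h ^+ 2 * (m * m)%:R / 2)
     * (n.+1%:R ^+ (8 * n) * #|two_level_tables m n a b|%:R) :> R.
Proof.
move=> m0 mn b01 c01 aE bE q01 qE tE ht /andP[h0 h1] ma manb k km kfar.
have [/andP[q0 q1] mm0] := (q01, ler0n R (m * m)).
set F := n.+1%:R ^+ (8 * n) * _ : R.
have F0 : 0 <= F by rewrite mulr_ge0 ?exprn_ge0.
have fF j : (j <= m * m)%N -> (0 : R) <= (block_count m n a b j)%:R <= F.
  move=> jm; rewrite ler0n /F -natrX -natrM ler_nat block_count_lower ?m0 //.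
    by rewrite (leq_trans jm) // leq_mul2l ma orbT.
  by rewrite (leq_trans (leq_subr _ _)).
pose f j : R := (block_count m n a b j)%:R.
have up := geometric_tail (g := f) (ltW h0) _ F0 fF _ km.
have down := geometric_tail_rev (g := f) (ltW h0) _ F0 fF _ km.
have weaken (x : R) : h * (m * m)%:R - 1 <= x -> 
    expR (- (h / 2) * x) * F <= expR (h / 2 - h ^+ 2 * (m * m)%:R / 2) * F.
  move=> hx; rewrite ler_wpM2r // ler_expR.
  have : h / 2 * (h * (m * m)%:R - 1) <= h / 2 * x by rewrite ler_pM2l // divr_gt0.
  by lra.
move: kfar; rewrite ler_normr => /orP[kf|kf].
  apply: le_trans (weaken (k%:R - (q + h) * (m * m)%:R - 1) _); last by lra.
  apply: up; first by rewrite mulr_ge0 //; lra.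
  move=> j jm xj; apply: (@block_count_decreasing R m n a b beta C q h tau) => //.
  by rewrite -natrM.
apply: le_trans (weaken ((q - h) * (m * m)%:R - k%:R - 1) _); last by lra.
apply: down; first by rewrite -[leRHS]mul1r ler_wpM2r //; lra.
move=> j jm xj; apply: (@block_count_increasing R m n a b beta C q h tau) => //.
by rewrite -natrM.
Qed.

Lemma card_level_union (R : realType) (T : finType) (S : {set T}) (g : T -> nat)
    (P : pred nat) (N : nat) (Z : R) :
  0 <= Z -> (forall x, x \in S -> (g x <= N)%N) ->
  (forall k, (k <= N)%N -> P k -> #|[set x in S | g x == k]|%:R <= Z) ->
  #|[set x in S | P (g x)]|%:R <= (N%:R + 1) * Z.
Proof.
move=> Z0 gN HZ.
have -> : #|[set x in S | P (g x)]| =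
    (\sum_(k < N.+1) #|[set x in S | P (g x) && (g x == k)]|)%N.
  rewrite -sum1_card (partition_big (fun x => inord (g x) : 'I_N.+1) predT) //=.
  apply: eq_bigr => k _; rewrite -sum1_card; apply: eq_bigl => x.
  rewrite !inE -andbA; case: (boolP (x \in S)) => //= xS; congr (_ && _).
  by rewrite -val_eqE /= inordK // ltnS gN.
rewrite natr_sum natr1 mulr_natl -[X in _ *+ X](card_ord N.+1) -sumr_const.
apply: ler_sum => k _; case: (boolP (P k)) => Pk.
  apply: le_trans (HZ k _ Pk); last by rewrite -ltnS.
  rewrite ler_nat; apply: subset_leq_card; apply/fintype.subsetP => x.
  by rewrite !inE => /and3P[-> _ ->].
rewrite (_ : [set x in S | _] = finset.set0) ?cards0 //.
by apply/setP => x; rewrite !inE; case: eqP => [->|_]; rewrite ?(negbTE Pk) ?andbF.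
Qed.

Lemma total_le (m l : nat) (M : 'M[bool]_(m, l)) : (total M <= m * l)%N.
Proof.
rewrite /total -sum_const_ord; apply: leq_sum => i _.
rewrite -[X in (_ <= X)%N]muln1 -sum_const_ord; apply: leq_sum => j _.
by case: (M i j).
Qed.

(** The mean of |k/m^2 - q| is at most 2h plus the probability that k is farther
than 2h m^2 from q m^2; that probability is at most m^2 + 1 times the bound
for a single value of k. *)
Lemma corner_entry_mean (R : realType) (m n a b : nat) (beta C q h tau : R)
    (i j : 'I_m) :
  (0 < m)%N -> (m <= n)%N -> 0 < beta < 1 -> 0 < C < 1 ->
  beta * n%:R - 1 <= a%:R <= beta * n%:R -> C * n%:R - 1 <= b%:R <= C * n%:R ->
  0 < q < 1 -> (1 - q) * (beta ^+ 2 * (1 - C)) = q * ((1 - beta) ^+ 2 * C) ->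
  tau * n%:R = m%:R + 1 ->
  6 * (tau / beta) + 6 * (tau / (1 - beta)) + 6 * (tau / C) + 6 * (tau / (1 - C)) <= h ->
  0 < h <= 1 -> (m <= a)%N -> (m * a <= n * b)%N ->
  two_level_tables m n a b != finset.set0 ->
  `|#|[set M in two_level_tables m n a b | M (lshift n i) (lshift n j)]|%:R
     / #|two_level_tables m n a b|%:R - q|
  <= 2 * h + ((m * m)%:R + 1) * n.+1%:R ^+ (8 * n)
     * expR (h / 2 - h ^+ 2 * (m * m)%:R / 2).
Proof.
move=> m0 mn b01 c01 aE bE q01 qE tE ht h01 ma manb T0.
have tail := corner_tail m0 mn b01 c01 aE bE q01 qE tE ht h01 ma manb.
have /andP[q0 q1] := q01; have /andP[h0 h1] := h01.
have := corner_entry_count n a b i j.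
set S := two_level_tables m n a b in T0 tail *.
rewrite {1}/entry_count -/(two_level_tables m n a b) -/S.
set N := #|finset _|; set E := expR _ in tail *; set W := _ ^+ (8 * n) in tail *.
move=> NE.
have S_gt0 : 0 < #|S|%:R :> R by rewrite ltr0n card_gt0.
have mm_gt0 : 0 < (m * m)%:R :> R by rewrite ltr0n muln_gt0 m0.
have ZE : 0 <= E * (W * #|S|%:R) by rewrite !mulr_ge0 ?expR_ge0 ?exprn_ge0.
pose far (k : nat) := 2 * h * (m * m)%:R <= `|k%:R - q * (m * m)%:R|.
have bad : #|[set M in S | far (total (ulsubmx M))]|%:R
    <= ((m * m)%:R + 1) * (E * (W * #|S|%:R)).
  apply: card_level_union => // [M _|k km kf]; first exact: total_le.
  by apply: le_trans (tail k km kf); rewrite ler_nat card_corner_total_upper.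
have step (M : 'M[bool]_(m + n)) : M \in S ->
    `|(total (ulsubmx M))%:R - q * (m * m)%:R| <=
    (m * m)%:R * (2 * h) + (if far (total (ulsubmx M)) then (m * m)%:R else 0).
  move=> _; rewrite /far; case: ifPn => [d|]; last first.
    by rewrite -ltNge => d; rewrite addr0 [leRHS]mulrC ltW.
  have tm : (total (ulsubmx M))%:R <= (m * m)%:R :> R by rewrite ler_nat total_le.
  have t0 := ler0n R (total (ulsubmx M)).
  have : 0 <= (m * m)%:R * (2 * h) by rewrite !mulr_ge0 // ltW.
  have : q * (m * m)%:R <= (m * m)%:R by rewrite ger_pMl // ltW.
  have : 0 <= q * (m * m)%:R by rewrite mulr_ge0 // ltW.
  by rewrite ler_norml => *; apply/andP; split; lra.
have key : `|(m * m)%:R * N%:R - q * (m * m)%:R * #|S|%:R| <=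
    (m * m)%:R * (2 * h) * #|S|%:R
    + (m * m)%:R * #|[set M in S | far (total (ulsubmx M))]|%:R.
  rewrite -natrM -mulnA NE natr_sum [q * _ * _]mulr_natr [_ * (2 * h) * _]mulr_natr.
  rewrite [(m * m)%:R * #|_|%:R]mulr_natr -!sumr_const.
  rewrite (_ : \sum_(M in [set M in S | _]) _ =
    \sum_(M in S) (if far (total (ulsubmx M)) then (m * m)%:R else 0)); last first.
    by rewrite -big_mkcondr; apply: eq_bigl => M; rewrite inE.
  rewrite -sumrB -big_split /=.
  by apply: le_trans (ler_norm_sum _ _ _) _; apply: ler_sum => M; exact: step.
have -> : N%:R / #|S|%:R - q = ((m * m)%:R * N%:R - q * (m * m)%:R * #|S|%:R)
    / ((m * m)%:R * #|S|%:R) by field; rewrite (gt_eqF S_gt0) pnatr_eq0 -lt0n m0.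
rewrite normrM normfV [X in _ / X]gtr0_norm ?mulr_gt0 // ler_pdivrMr ?mulr_gt0 //.
apply: (le_trans key).
rewrite [leRHS](_ : _ = (m * m)%:R * (2 * h) * #|S|%:R +
  (m * m)%:R * (((m * m)%:R + 1) * (E * (W * #|S|%:R)))); last by ring.
by rewrite lerD2l ler_pM2l.
Qed.

(** * Asymptotics in n *)

Local Open Scope classical_set_scope.
Local Open Scope ring_scope.

Lemma tablesE (R : realType) (delta B C : R) n :
  tables delta B C n = two_level_tables (nheavy delta n) n
    (Num.truncn (B * C * n%:R)) (Num.truncn (C * n%:R)).
Proof. by []. Qed.

Lemma truncn_bounds (R : realType) (x : R) :
  0 <= x -> x - 1 <= (Num.truncn x)%:R <= x.
Proof.
by move=> /truncn_itv /andP[H1 H2]; rewrite H1 andbT lerBlDr -natr1 in H2 *; exact: ltW.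
Qed.

Lemma nheavy_bounds (R : realType) (delta : R) n :
  0 <= delta <= 1 -> (0 < n)%N ->
  [/\ (0 < nheavy delta n)%N, (nheavy delta n <= n)%N,
      (nheavy delta n)%:R + 1 <= 2 * n%:R `^ delta
    & n%:R `^ delta <= 2 * (nheavy delta n)%:R].
Proof.
move=> /andP[d0 d1] n0; have n1 : 1 <= n%:R :> R by rewrite ler1n.
have p1 : 1 <= n%:R `^ delta by rewrite -[leLHS](powRr0 n%:R) ler_powR.
have pn : n%:R `^ delta <= n%:R by rewrite -[leRHS](powRr1 (ler0n _ _)) ler_powR.
have /andP[H1 H2] := truncn_bounds (powR_ge0 n%:R delta).
rewrite -/(nheavy delta n) in H1 H2.
have m0 : (0 < nheavy delta n)%N by rewrite truncn_gt0.
have m1 : 1 <= (nheavy delta n)%:R :> R by rewrite ler1n.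
split => //; last 2 first.
- by lra.
- by lra.
by rewrite -(ler_nat R) (le_trans H2).
Qed.

Lemma heavy_fraction (R : realType) (delta : R) n :
  0 <= delta <= 1 -> (0 < n)%N ->
  ((nheavy delta n)%:R + 1) / n%:R <= 2 * n%:R `^ (delta - 1).
Proof.
move=> d01 n0; have [_ _ H _] := nheavy_bounds d01 n0.
have n1 : 0 < n%:R :> R by rewrite ltr0n.
rewrite powRB; last by rewrite (gt_eqF n1) ?implybT.
by rewrite powRr1 ?(ltW n1) // [leRHS]mulrA ler_pM2r ?invr_gt0.
Qed.

Lemma near_powR_small (R : realType) (x e : R) :
  x < 0 -> 0 < e -> \forall n \near \oo, (0 < n)%N /\ n%:R `^ x <= e.
Proof.
move=> x0 e0; near=> n; have n0 : (0 < n)%N by near: n; exists 1%N.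
split => //; have ne : (e^-1) `^ (- x)^-1 <= n%:R by near: n; exact: nbhs_infty_ger.
have Nx0 : 0 < - x by rewrite oppr_gt0.
rewrite -[x]opprK powRN -[e]invrK lef_pV2 ?posrE ?invr_gt0 ?powR_gt0 ?ltr0n //.
have := ge0_ler_powR (ltW Nx0) _ _ ne; rewrite !nnegrE powR_ge0 ler0n => /(_ isT isT).
by rewrite -powRrM mulVf ?gt_eqF // powRr1 // invr_ge0 ltW.
Unshelve. all: by end_near. Qed.

Lemma near_heavy_le_light (R : realType) (delta x : R) :
  0 <= delta < 1 -> 0 < x -> \forall n \near \oo,
  (0 < n)%N /\ (nheavy delta n <= Num.truncn (x * n%:R))%N.
Proof.
move=> /andP[d0 d1] x0; near=> n.
have [n0 small] : (0 < n)%N /\ n%:R `^ (delta - 1) <= x / 2.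
  by near: n; apply: near_powR_small; rewrite ?subr_lt0 ?divr_gt0.
split => //; have n1 : 0 < n%:R :> R by rewrite ltr0n.
have := @heavy_fraction R delta n _ n0; rewrite d0 (ltW d1) => /(_ isT) H.
rewrite -(ler_nat R).
have : (nheavy delta n)%:R + 1 <= x * n%:R.
  by rewrite -ler_pdivrMr //; lra.
have /andP[] : x * n%:R - 1 <= (Num.truncn (x * n%:R))%:R <= x * n%:R.
  by apply: truncn_bounds; rewrite mulr_ge0 // ltW.
by lra.
Unshelve. all: by end_near. Qed.

(** The lower bound on the number of tables is already positive for k = 0, when
the corner is filled with zeros. *)
Lemma tables_nonempty (R : realType) (delta B C : R) n :
  0 < B -> 0 < C < 1 -> B * C <= 1 -> 0 <= delta <= 1 -> (0 < n)%N ->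
  (nheavy delta n <= Num.truncn (C * n%:R))%N ->
  tables delta B C n != finset.set0.
Proof.
move=> B0 /andP[C0 C1] BC d01 n0 mb; rewrite tablesE.
have [m0 mn _ _] := nheavy_bounds d01 n0.
set m := nheavy delta n in m0 mn mb *; set a := Num.truncn (B * C * n%:R).
set b := Num.truncn _ in mb *.
have an : (a <= n)%N.
  rewrite -(ler_nat R); have /andP[_ H] : B * C * n%:R - 1 <= a%:R <= B * C * n%:R.
    by apply: truncn_bounds; rewrite !mulr_ge0 // ltW.
  by rewrite (le_trans H) // ler_piMl.
have bn : (b <= n)%N.
  rewrite -(ler_nat R); have /andP[_ H] : C * n%:R - 1 <= b%:R <= C * n%:R.
    by apply: truncn_bounds; rewrite !mulr_ge0 // ltW.
  by rewrite (le_trans H) // ler_piMl // ltW.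
have manb : (m * a <= n * b)%N by rewrite [leqRHS]mulnC leq_mul.
have f0 : (0 < block_count m n a b 0)%N.
  rewrite /block_count subn0 !muln_gt0 ?expn_gt0 !bin_gt0 /= leq_mul2l an orbT /=.
  by rewrite (leq_trans (leq_subr _ _)) // leq_mul2l bn orbT.
have := @block_count_lower m n a b 0; rewrite m0 mn subn0 => /(_ isT isT manb).
by move=> /(leq_trans f0); rewrite muln_gt0 card_gt0 => /andP[].
Qed.

Lemma corner_limit_bounds (R : realType) (beta C : R) :
  0 < beta < 1 -> 0 < C < 1 ->
  let q := beta ^+ 2 * (1 - C) / ((1 - beta) ^+ 2 * C + beta ^+ 2 * (1 - C)) in
  0 < q < 1 /\ (1 - q) * (beta ^+ 2 * (1 - C)) = q * ((1 - beta) ^+ 2 * C).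
Proof.
move=> /andP[b0 b1] /andP[c0 c1] /=.
have U0 : 0 < beta ^+ 2 * (1 - C) by rewrite mulr_gt0 ?exprn_gt0 ?subr_gt0.
have V0 : 0 < (1 - beta) ^+ 2 * C by rewrite mulr_gt0 ?exprn_gt0 ?subr_gt0.
move: (_ * _) (_ * C) U0 V0 => U V U0 V0.
have UV : 0 < V + U by rewrite addr_gt0.
split; first by rewrite divr_gt0 //= ltr_pdivrMr // mul1r ltrDr.
by field; rewrite gt_eqF.
Qed.

(** The prefactor is at most (n+1)^(10 n), and
ln(n+1) = ln((n+1)^(2 eps))/(2 eps) <= (2n)^(2 eps)/(2 eps). *)
Lemma prefactor_le_exp (R : realType) (eps : R) (m n : nat) :
  0 < eps -> (0 < n)%N -> (m <= n)%N ->
  ((m * m)%:R + 1) * n.+1%:R ^+ (8 * n)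
  <= expR (10 * (2 `^ (2 * eps) / (2 * eps)) * n%:R `^ (1 + 2 * eps)).
Proof.
move=> e0 n0 mn; have n1 : 0 < n%:R :> R by rewrite ltr0n.
have e2 : 0 < 2 * eps by rewrite mulr_gt0.
apply: (@le_trans _ _ (n.+1%:R ^+ (10 * n))).
  rewrite natr1 -!natrX -natrM ler_nat.
  apply: (@leq_trans (n.+1 ^ 2 * n.+1 ^ (8 * n))).
    rewrite leq_mul2r; apply/orP; right.
    by have := leq_mul mn mn; rewrite -mulnn; lia.
  by rewrite -expnD leq_pexp2l //; lia.
rewrite -[n.+1%:R](@lnK R) ?posrE // -expRM_natl ler_expR.
have lnn : ln n.+1%:R <= 2 `^ (2 * eps) / (2 * eps) * n%:R `^ (2 * eps) :> R.
  rewrite mulrAC ler_pdivlMr // mulrC -ln_powR.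
  apply: (@le_trans _ _ (n.+1%:R `^ (2 * eps))).
    by rewrite ltW // ln_sublinear // powR_gt0.
  rewrite -powRM //; apply: ge0_ler_powR; rewrite ?nnegrE ?(ltW e2) ?mulr_ge0 //.
  have n_ge1 : 1 <= n%:R :> R by rewrite ler1n.
  by rewrite -natr1; lra.
rewrite powRD; last by rewrite (gt_eqF n1) ?implybT.
rewrite powRr1 ?(ltW n1) // natrM.
rewrite [leRHS](_ : _ = 10 * n%:R * (2 `^ (2 * eps) / (2 * eps) * n%:R `^ (2 * eps)));
  last by ring.
by rewrite ler_wpM2l // mulr_ge0 // ltW.
Qed.

(** Since m >= n^delta/2, the hypotheses on A make h^2 m^2/2 at least
(10 L + 1) n^(1 + 2 eps).  The part 10 L n^(1 + 2 eps) absorbs the prefactor;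
the rest leaves exp(1/2 - n), and exp(-n) <= 1/n <= n^(delta-1). *)
Lemma tail_term_le (R : realType) (eps delta A h : R) (m n : nat) :
  let L := 2 `^ (2 * eps) / (2 * eps) in
  0 < eps -> 0 <= delta -> (0 < n)%N -> (m <= n)%N ->
  n%:R `^ delta <= 2 * m%:R -> 0 <= h <= 1 ->
  8 * (10 * L + 1) <= A -> A * n%:R `^ (1 / 2 - delta + eps) <= h ->
  ((m * m)%:R + 1) * n.+1%:R ^+ (8 * n) * expR (h / 2 - h ^+ 2 * (m * m)%:R / 2)
  <= expR (1 / 2) * n%:R `^ (delta - 1).
Proof.
move=> L e0 d0 n0 mn md /andP[h0 h1] A8 Ah.
have n1 : 0 < n%:R :> R by rewrite ltr0n.
have n_ge1 : 1 <= n%:R :> R by rewrite ler1n.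
have L0 : 0 <= L by rewrite divr_ge0 ?powR_ge0 // mulr_ge0 // ltW.
have nI x : (x != 0 :> R) ==> (n%:R != 0 :> R) by rewrite (gt_eqF n1) ?implybT.
set N := n%:R `^ (1 + 2 * eps).
have N0 : n%:R <= N.
  by rewrite -[leLHS](powRr1 (ltW n1)) ler_powR // lerDl mulr_ge0 // ltW.
have A0 : 0 <= A by lra.
have A1 : 1 <= A by lra.
have hm : A * N / 4 <= h ^+ 2 * (m * m)%:R.
  set s := n%:R `^ (1 / 2 - delta + eps) in Ah.
  have NE : N = (s * n%:R `^ delta) ^+ 2.
    rewrite /s -powRD; last by rewrite (gt_eqF n1) ?implybT.
    rewrite -powR_mulrn ?powR_ge0 // -powRrM /N; congr (_ `^ _); by field.
  have s0 : 0 <= s by rewrite powR_ge0.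
  have t0 : 0 <= n%:R `^ delta by rewrite powR_ge0.
  apply: (@le_trans _ _ ((A * s) ^+ 2 * (n%:R `^ delta / 2) ^+ 2)).
    rewrite (_ : _ * _ ^+ 2 = A ^+ 2 * N / 4); last by rewrite NE; field.
    by rewrite ler_pM2r ?invr_gt0 // ler_wpM2r ?powR_ge0 // expr2 ler_peMl.
  rewrite natrM -expr2; apply: ler_pM; rewrite ?sqr_ge0 //.
    by rewrite ler_pXn2r ?nnegrE // mulr_ge0.
  rewrite ler_pXn2r ?nnegrE ?divr_ge0 //; lra.
have pre := prefactor_le_exp e0 n0 mn; rewrite -/L -/N in pre.
apply: (le_trans (ler_wpM2r (expR_ge0 _) pre)).
rewrite -expRD; apply: (@le_trans _ _ (expR (1 / 2 - n%:R))).
  rewrite ler_expR.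
  have : 8 * (10 * L + 1) * N <= A * N by rewrite ler_wpM2r // powR_ge0.
  by lra.
rewrite expRD ler_wpM2l ?expR_ge0 //.
apply: (@le_trans _ _ (n%:R `^ (- 1))); last by rewrite ler_powR // lerDr.
rewrite expRN powRN powRr1 ?(ltW n1) // lef_pV2 ?posrE ?expR_gt0 //.
by rewrite (le_trans _ (expR_ge1Dx _)) // lerDr.
Qed.

(** * The three blocks *)

(** Serves the bottom right block, with a light row i, and the side blocks, with
a heavy one. *)
Lemma light_column_dTV (R : realType) (B C delta x : R) n (i j : 'I_(tdim delta n)) :
  0 <= delta <= 1 -> (0 < n)%N -> (nheavy delta n <= j)%N ->
  tables delta B C n != finset.set0 ->
  x * n%:R - 1 <= (margin B C i)%:R <= x * n%:R ->
  (dTV (entry_law R (tables delta B C n) i j) (Ber x)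
   <= (2 * n%:R `^ (delta - 1))%:E)%E.
Proof.
move=> d01 n0 mj T0 hx; rewrite dTV_entry_law // lee_fin.
apply: le_trans (heavy_fraction d01 n0).
exact: entry_mean_bounds.
Qed.

Lemma dTV_tables_tr (R : realType) (B C delta x : R) n (i j : 'I_(tdim delta n)) :
  tables delta B C n != finset.set0 ->
  dTV (entry_law R (tables delta B C n) i j) (Ber x) =
  dTV (entry_law R (tables delta B C n) j i) (Ber x).
Proof.
move=> T0; rewrite !dTV_entry_law //.
have := entry_count_tr (@margin R delta B C n) (@margin R delta B C n) i j.
by rewrite /entry_count => ->.
Qed.

(** BC < 1 keeps the limiting densities of all blocks strictly between 0 and 1. *)
Lemma subcritical_BC (R : realType) (B C : R) :
  0 < B -> 0 < C -> B < 1 / (Num.sqrt (C / 3 - C ^+ 2 / 3) + C) -> B * C < 1.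
Proof.
move=> B0 C0; have s0 := sqrtr_ge0 (C / 3 - C ^+ 2 / 3).
rewrite ltr_pdivlMr; last by rewrite ltr_wpDl.
by apply: le_lt_trans; rewrite ler_wpM2l ?lerDr // ltW.
Qed.

(** Multiplying numerator and denominator by C^2 turns the limit of the theorem
into a form symmetric under exchange of zeros and ones. *)
Lemma corner_limitE (R : realType) (B C : R) : 0 < C ->
  B ^+ 2 * (1 - C) / (B ^+ 2 - 2 * B + 1 / C) =
  (B * C) ^+ 2 * (1 - C) / ((1 - B * C) ^+ 2 * C + (B * C) ^+ 2 * (1 - C)).
Proof.
move=> C0.
have -> : (1 - B * C) ^+ 2 * C + (B * C) ^+ 2 * (1 - C) =
    C ^+ 2 * (B ^+ 2 - 2 * B + 1 / C) by field; rewrite gt_eqF.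
have C2 : C ^+ 2 != 0 by rewrite expf_neq0 // gt_eqF.
rewrite [(B * C) ^+ 2 * _](_ : _ = C ^+ 2 * (B ^+ 2 * (1 - C))); last by ring.
by rewrite -mulf_div (mulfV C2) [RHS]mul1r.
Qed.

(** The constant A serves two purposes: 2 kappa makes h exceed the relative
errors of the ratios, and 8 (10 L + 1) makes the exponential tail beat the
entropy factor.  If h > 1 the bound is trivial, both means lying in [0, 1]. *)
Lemma corner_dTV (R : realType) (B C delta eps : R) :
  0 < B -> 0 < C < 1 -> B * C < 1 -> 0 < eps -> 0 <= delta < 1 ->
  exists K : R, \forall n \near \oo, forall i1 : 'I_(tdim delta n),
    i1 = 0%N :> nat ->
    (dTV (entry_law R (tables delta B C n) i1 i1)
         (Ber ((B ^+ 2 * (1 - C)) / (B ^+ 2 - 2 * B + 1 / C)))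
     <= (K * (n%:R `^ (delta - 1) + n%:R `^ (1 / 2 - delta + eps)))%:E)%E.
Proof.
move=> B0 C01 BC e0 d01; have /andP[C0 C1] := C01; have /andP[d0 d1] := d01.
have dle : 0 <= delta <= 1 by rewrite d0 ltW.
set beta := B * C in BC *; have b0 : 0 < beta by rewrite mulr_gt0.
have b01 : 0 < beta < 1 by rewrite b0.
rewrite corner_limitE // -/beta.
have [q01 qE] := corner_limit_bounds b01 C01.
set q := beta ^+ 2 * (1 - C) / _ in q01 qE *.
pose kappa := 6 / beta + 6 / (1 - beta) + 6 / C + 6 / (1 - C).
have k0 : 0 < kappa by rewrite !addr_gt0 ?divr_gt0 ?subr_gt0.
pose L : R := 2 `^ (2 * eps) / (2 * eps).
have L0 : 0 < L by rewrite divr_gt0 ?powR_gt0 ?mulr_gt0.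
pose A := 8 * (10 * L + 1) + 2 * kappa.
exists (2 * A + expR (1 / 2)); near=> n => i1 i10.
have [n0 mb] : (0 < n)%N /\ (nheavy delta n <= Num.truncn (C * n%:R))%N.
  by near: n; apply: near_heavy_le_light.
have [_ ma] : (0 < n)%N /\ (nheavy delta n <= Num.truncn (B * C * n%:R))%N.
  by near: n; apply: near_heavy_le_light.
have T0 := tables_nonempty B0 C01 (ltW BC) dle n0 mb.
rewrite dTV_entry_law // lee_fin.
have [m0 mn md1 md2] := nheavy_bounds dle n0.
have n1 : 0 < n%:R :> R by rewrite ltr0n.
set s := n%:R `^ (1 / 2 - delta + eps); set t := n%:R `^ (delta - 1).
have s0 : 0 < s by rewrite powR_gt0.
have t0 : 0 < t by rewrite powR_gt0.
pose h := A * (t + s).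
have A0 : 0 < A by rewrite /A; lra.
have h0 : 0 < h by rewrite mulr_gt0 // addr_gt0.
rewrite mulrDl -mulrA -/h.
have e12 := expR_gt0 (1 / 2 : R).
(* For h > 1 a distance between two numbers of [0, 1] is below h. *)
have [h1|h1] := leP h 1; last first.
  set p := (X in `|X - q|).
  have p0 : 0 <= p by rewrite divr_ge0.
  have p1 : p <= 1.
    rewrite ler_pdivrMr ?ltr0n ?card_gt0 // mul1r ler_nat.
    exact: entry_count_le.
  have : 0 <= expR (1 / 2) * (t + s) by rewrite mulr_ge0 // ltW // addr_gt0.
  move: q01 => /andP[q0 q1]; clearbody p; rewrite ler_norml => ?.
  by apply/andP; split; lra.
pose tau := ((nheavy delta n)%:R + 1) / n%:R : R.
have tauE : tau * n%:R = (nheavy delta n)%:R + 1 by rewrite divfK // gt_eqF.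
have tau_le : tau <= 2 * t := heavy_fraction dle n0.
have aE : beta * n%:R - 1 <= (Num.truncn (B * C * n%:R))%:R <= beta * n%:R.
  by apply: truncn_bounds; rewrite mulr_ge0 // ltW.
have bE : C * n%:R - 1 <= (Num.truncn (C * n%:R))%:R <= C * n%:R.
  by apply: truncn_bounds; rewrite mulr_ge0 // ltW.
have an : (Num.truncn (B * C * n%:R) <= n)%N.
  rewrite -(ler_nat R); case/andP: aE => _ /le_trans; apply.
  by rewrite ler_piMl // ltW.
have manb : (nheavy delta n * Num.truncn (B * C * n%:R)
    <= n * Num.truncn (C * n%:R))%N by rewrite [leqRHS]mulnC leq_mul.
have kt : 6 * (tau / beta) + 6 * (tau / (1 - beta)) + 6 * (tau / C)
    + 6 * (tau / (1 - C)) <= h.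
  rewrite [leLHS](_ : _ = kappa * tau); last by rewrite /kappa; ring.
  apply: (@le_trans _ _ (kappa * (2 * t))); first by rewrite ler_pM2l.
  have : 0 <= (8 * (10 * L + 1)) * t by rewrite mulr_ge0 ?ltW //; lra.
  have : 0 <= A * s by rewrite mulr_ge0 // ltW.
  by rewrite /h /A; lra.
have As : A * s <= h.
  have : 0 <= A * t by rewrite mulr_ge0 // ltW.
  by rewrite /h; lra.
have A8 : 8 * (10 * L + 1) <= A by rewrite /A; lra.
have h01 : 0 < h <= 1 by rewrite h0.
have iE : i1 = lshift n (Ordinal m0) by apply: val_inj.
rewrite iE.
apply: le_trans (corner_entry_mean (Ordinal m0) (Ordinal m0) m0 mn b01 C01 aE bE
  q01 qE tauE kt h01 ma manb T0) _.
rewrite lerD2l.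
have h01' : 0 <= h <= 1 by rewrite ltW.
apply: le_trans (tail_term_le e0 d0 n0 mn md2 h01' A8 As) _.
by rewrite ler_pM2l // lerDl ltW.
Unshelve. all: by end_near. Qed.

(* The index i1 (resp. iN) is the paper's index 1 (resp. n+1); both lie in
   'I_(tdim delta n) as soon as 0 <= delta and 1 <= n. *)
Theorem theorem1p2 (R : realType) (B C delta eps : R)
    (hB : 0 < B) (hC : 0 < C) (heps : 0 < eps) :
  [/\ (0 <= delta < 1 -> C < 1 -> B <= 1 / C ->
       exists K : R, \forall n \near \oo,
         tables delta B C n != finset.set0 /\
         forall iN : 'I_(tdim delta n), iN = n :> nat ->
           (dTV (entry_law R (tables delta B C n) iN iN) (Ber C)
            <= (K * (n%:R `^ (delta - 1) + n%:R `^ (- (1 / 2) + eps)))%:E)%E),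
      (1 / 2 < delta < 1 -> C < 3 / 4 ->
       B < 1 / (Num.sqrt (C / 3 - C ^+ 2 / 3) + C) ->
       exists K : R, \forall n \near \oo,
         tables delta B C n != finset.set0 /\
         forall i1 : 'I_(tdim delta n), i1 = 0%N :> nat ->
           (dTV (entry_law R (tables delta B C n) i1 i1)
                (Ber ((B ^+ 2 * (1 - C)) / (B ^+ 2 - 2 * B + 1 / C)))
            <= (K * (n%:R `^ (delta - 1) + n%:R `^ (1 / 2 - delta + eps)))%:E)%E)
    & (0 < delta < 1 -> C < 3 / 4 ->
       B < 1 / (Num.sqrt (C / 3 - C ^+ 2 / 3) + C) ->
       exists K : R, \forall n \near \oo,
         tables delta B C n != finset.set0 /\
         forall i1 iN : 'I_(tdim delta n), i1 = 0%N :> nat -> iN = n :> nat ->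
           dTV (entry_law R (tables delta B C n) i1 iN) (Ber (B * C))
           = dTV (entry_law R (tables delta B C n) iN i1) (Ber (B * C)) /\
           (dTV (entry_law R (tables delta B C n) i1 iN) (Ber (B * C))
            <= (K * (n%:R `^ (delta - 1) + n%:R `^ (- (delta / 2) + eps)))%:E)%E)].
Proof.
have light (n : nat) (j : 'I_(tdim delta n)) : 0 <= delta <= 1 -> (0 < n)%N ->
    j = n :> nat -> (nheavy delta n <= j)%N.
  by move=> d01 n0 ->; have [] := nheavy_bounds d01 n0.
have le_sum (x y : R) n : (2 * n%:R `^ x <= 2 * (n%:R `^ x + n%:R `^ y)).
  by rewrite ler_pM2l // lerDl powR_ge0.
have side_hyp : 0 < delta < 1 -> 0 <= delta < 1 by case/andP=> /ltW -> ->.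
split.
- move=> d01 C1 BC; have /andP[d0 d1] := d01.
  have dle : 0 <= delta <= 1 by rewrite d0 ltW.
  have C01 : 0 < C < 1 by rewrite hC.
  have BC1 : B * C <= 1 by rewrite -ler_pdivlMr.
  exists 2; near=> n.
  have [n0 mb] : (0 < n)%N /\ (nheavy delta n <= Num.truncn (C * n%:R))%N.
    by near: n; apply: near_heavy_le_light.
  have T0 := tables_nonempty hB C01 BC1 dle n0 mb.
  split => // iN iNn; have mi := light n iN dle n0 iNn.
  apply: le_trans (light_column_dTV dle n0 mi T0 _) _; last by rewrite lee_fin.
  rewrite /margin ltnNge mi /=; apply: truncn_bounds.
  by rewrite mulr_ge0 // ltW.
- move=> /andP[d12 d1] C34 Bs; have BC := subcritical_BC hB hC Bs.
  have C01 : 0 < C < 1 by rewrite hC; lra.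
  have d01 : 0 <= delta < 1 by rewrite d1 andbT; lra.
  have dle : 0 <= delta <= 1 by rewrite (ltW d1) andbT; lra.
  have [K HK] := corner_dTV hB C01 BC heps d01.
  exists K; near=> n; split; last by near: n.
  have [n0 mb] : (0 < n)%N /\ (nheavy delta n <= Num.truncn (C * n%:R))%N.
    by near: n; apply: near_heavy_le_light.
  exact: tables_nonempty (ltW BC) dle n0 mb.
move=> /side_hyp d01 C34 Bs; have BC := subcritical_BC hB hC Bs.
have /andP[d0 d1] := d01; have dle : 0 <= delta <= 1 by rewrite d0 ltW.
have C01 : 0 < C < 1 by rewrite hC; lra.
exists 2; near=> n.
have [n0 mb] : (0 < n)%N /\ (nheavy delta n <= Num.truncn (C * n%:R))%N.
  by near: n; apply: near_heavy_le_light.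
have T0 := tables_nonempty hB C01 (ltW BC) dle n0 mb.
split => // i1 iN i10 iNn; split; first exact: dTV_tables_tr.
have mi := light n iN dle n0 iNn.
apply: le_trans (light_column_dTV dle n0 mi T0 _) _; last by rewrite lee_fin.
have [m0 _ _ _] := nheavy_bounds dle n0.
rewrite /margin i10 m0; apply: truncn_bounds.
by rewrite !mulr_ge0 // ltW.
Unshelve. all: by end_near. Qed.
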